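(* Let $G$ be a model of a metric graph $\Gamma$, with $m$ edges, and fix an orientation $\mathcal O$ of $G$. Let $\pi_G\colon C_1(G,\mathbb R)\to H_1(G,\mathbb R)$ and $\pi'_G\colon C_1(G,\mathbb R)\to H_1(G,\mathbb R)^{\perp}$ be the orthogonal projections. Let $\mathbf\Xi=\left(\xi(e^-,e^+,f^-,f^+)\right)_{e,f\in\mathcal O}$ be the $m\times m$ matrix of cross ratios, let $\mathbf D$ be the $m\times m$ diagonal matrix whose diagonal entries are $\ell(e)$, $e\in\mathcal O$, and let $\mathbf I$ be the $m\times m$ identity matrix. Then, in the basis of $C_1(G,\mathbb R)$ given by $\mathcal O$, the matrix of $\pi_G$ is $\mathbf I-\mathbf D^{-1}\mathbf\Xi$, and the matrix of $\pi'_G$ is $\mathbf D^{-1}\mathbf\Xi$.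
   Context: A metric graph $\Gamma$ is a compact connected metric space, not reduced to a point, such that every point has a neighborhood isometric to a star-shaped set, endowed with the path metric. A vertex set of $\Gamma$ is a finite set $V\subset\Gamma$ containing all points of valency different from $2$ such that the closure of each connected component of $\Gamma\setminus V$ is isometric with a closed interval. A model $G$ of $\Gamma$ is the weighted graph with vertex set $V(G)=V$ for some vertex set $V$, with edge set $E(G)$ the connected components of $\Gamma\setminus V$, and edge lengths $\ell\colon E(G)\to\mathbb R_{>0}$ (finite connected multigraph without loops). Each edge gives two oriented edges $e,\bar e$, with head $e^+$, tail $e^-$ and $\ell(e)=\ell(\bar e)$; an orientation $\mathcal O$ is a choice of exactly one of $e,\bar e$ for each edge. $C_1(G,\mathbb R)=\bigoplus_{e\in\mathcal O}\mathbb R e$ (with $\bar e=-e$), $C_0(G,\mathbb R)=\bigoplus_{v\in V(G)}\mathbb R v$, $\partial(e)=e^+-e^-$, and $H_1(G,\mathbb R)=\ker\partial$. $C_1(G,\mathbb R)$ carries the inner product with $[e,e]=\ell(e)$ and $[e,f]=0$ for distinct $e,f\in\mathcal O$; orthogonality is with respect to it. The projections are viewed as endomorphisms of $C_1(G,\mathbb R)$, and matrices act on column coordinate vectors. For $y,z\in\Gamma$, $j_z(\cdot,y)$ is the unique continuous piecewise affine function on $\Gamma$ (finitely many changes of slope) with $\Delta(j_z(\cdot,y))=\delta_y-\delta_z$ and $j_z(z,y)=0$, where $\Delta(\phi)=\sum_p\sigma_p(\phi)\delta_p$ and $\sigma_p(\phi)$ is the sum of incoming slopes of $\phi$ at $p$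 (minus the sum of outgoing directional derivatives). The cross ratio is $\xi(x,y,z,w)=j_q(x,z)+j_q(y,w)-j_q(x,w)-j_q(y,z)$ for any $q\in\Gamma$; it is independent of $q$. *)

(* Defs.v *)
From HB Require Import structures.
From mathcomp Require Import all_boot all_order all_algebra finmap.
From mathcomp Require Import all_classical all_reals all_analysis.
From mathcomp Require Import metric_structure sesquilinear.

Set Implicit Arguments.
Unset Strict Implicit.
Unset Printing Implicit Defensive.
Import Order.TTheory GRing.Theory Num.Theory.
Import numFieldNormedType.Exports.
Local Open Scope classical_set_scope.
Local Open Scope ring_scope.

Section PathMetric.
Context {R : realType} {T : metricType R}.

(* Length of g restricted to [0, 1]: supremum, over the subdivisions
   0 = s_0 < s_1 < ... < s_k = 1, of \sum_i d(g(s_i), g(s_(i+1))). *)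
Definition path_length (g : R -> T) : \bar R :=
  ereal_sup [set (\sum_(0 <= i < size s)
      mdist (g (nth 1 (0 :: s) i)) (g (nth 1 (0 :: s) i.+1)))%:E
    | s in itv_partition 0 1].

(* The path metric of a subset A (+oo if x and y are not joined by a
   rectifiable path inside A). *)
Definition path_dist (A : set T) (x y : T) : \bar R :=
  ereal_inf [set path_length g | g in
    [set g : R -> T | [/\ {within `[0, 1], continuous g},
                         g @` `[0, 1] `<=` A, g 0 = x & g 1 = y]]].

(* An isometry from [0, L] onto A, where A carries its own path metric: the
   ambient distance between the ends of an edge may be smaller than the
   length of the edge. *)
Definition arc_parametrization (A : set T) (L : R) (phi : R -> T) : Prop :=
  [/\ 0 < L, phi @` `[0, L] = A &
      forall s t, s \in `[0, L] -> t \in `[0, L] ->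
        path_dist A (phi s) (phi t) = `|s - t|%:E].

End PathMetric.

Section MetricGraph.
Context {R : realType} {T : metricType R}.

(* The star-shaped set { t * exp(2 i pi k / n) : 0 <= t < r, k < n } is encoded
   by the pairs (k, t), all the (k, 0) being the centre; this is its path
   metric. *)
Definition star_dist (n : nat) (x y : 'I_n * R) : R :=
  if x.1 == y.1 then `|x.2 - y.2| else x.2 + y.2.

(* phi is an isometry from the star with n arms of length r onto a neighborhood
   of p, sending the centre to p. *)
Definition star_chart (p : T) (n : nat) (r : R) (phi : 'I_n -> R -> T) : Prop :=
  [/\ 0 < r, forall k, phi k 0 = p,
      forall k l s t, s \in `[0, r[ -> t \in `[0, r[ ->
        mdist (phi k s) (phi l t) = star_dist (k, s) (l, t) &
      nbhs p [set x | exists k t, (t \in `[0, r[) /\ x = phi k t]].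

Definition has_valency (p : T) (n : nat) : Prop :=
  exists r (phi : 'I_n -> R -> T), star_chart p r phi.

Definition edge_sets (V : set T) : set (set T) :=
  [set connected_component (~` V) x | x in ~` V].

Definition vertex_set (V : set T) : Prop :=
  [/\ finite_set V,
      forall p n, has_valency p n -> n <> 2%N -> V p &
      forall C, edge_sets V C ->
        exists L phi, arc_parametrization (closure C) L phi].

(* The support of an oriented edge is the underlying connected component of
   the complement of the vertex set; the opposite edge swaps tail and head. *)
Record oriented_edge := OrientedEdge {
  support : set T;
  tail : T;
  head : T }.

Definition is_oriented_edge (V : set T) (e : oriented_edge) : Prop :=
  [/\ edge_sets V (support e), V (tail e), V (head e) &
      exists L phi, [/\ arc_parametrization (closure (support e)) L phi,
                        phi 0 = tail e & phi L = head e]].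

Definition edge_length (e : oriented_edge) : R :=
  fine (path_dist (closure (support e)) (tail e) (head e)).

(* A choice of exactly one of the two oriented edges over each edge, listed as
   O 0, ..., O (m - 1); in particular the model has exactly m edges. *)
Definition orientation (V : set T) (m : nat) (O : 'I_m -> oriented_edge) : Prop :=
  (forall k, is_oriented_edge V (O k)) /\
  (forall C, edge_sets V C -> exists! k, support (O k) = C).

(* p has valency 2 and f does not change slope at p. *)
Definition affine_near (f : T -> R) (p : T) : Prop :=
  exists r (phi : 'I_2 -> R -> T) a, star_chart p r phi /\
    forall t, t \in `[0, r[ ->
      f (phi ord0 t) = f p + a * t /\ f (phi ord_max t) = f p - a * t.

Definition continuous_piecewise_affine (f : T -> R) : Prop :=
  continuous f /\ finite_set [set p | ~ affine_near f p].

(* sigma_p(f) = s: s is the opposite of the sum of the outgoing directional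
   derivatives of f along the arms at p. *)
Definition is_sigma (f : T -> R) (p : T) (s : R) : Prop :=
  exists n r (phi : 'I_n -> R -> T) (a : 'I_n -> R),
    [/\ star_chart p r phi,
        forall k, (f (phi k t) - f p) / t @[t --> 0^'+] --> a k &
        s = - \sum_k a k].

(* Delta(f) = delta_y - delta_z *)
Definition laplacian_dirac_diff (f : T -> R) (y z : T) : Prop :=
  forall p, is_sigma f p ((p == y)%:R - (p == z)%:R).

(* jfun z y x is j_z(x, y). *)
Definition jfun (z y : T) : T -> R :=
  xget (fun=> 0) [set f | [/\ continuous_piecewise_affine f,
                              laplacian_dirac_diff f y z & f z = 0]].

Definition cross_ratio (q x y z w : T) : R :=
  jfun q z x + jfun q w y - jfun q w x - jfun q z y.

End MetricGraph.

Arguments oriented_edge {R} T.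

Definition metric_graph (R : realType) (T : metricType R) : Prop :=
  [/\ compact [set: T], connected [set: T], exists x y : T, x <> y,
      forall p : T, exists n, has_valency p n &
      forall x y : T, path_dist setT x y = (mdist x y)%:E].

(* C_1(G, R) is 'cV[R]_m, a chain being identified with its column of
   coordinates in the basis O; the basis vector O k is delta_mx k 0. *)
Section Chains.
Context {R : realType} {T : metricType R} (V : {fset T}) (m : nat).
Variable O : 'I_m -> oriented_edge T.

Definition boundary (c : 'cV[R]_m) : {ffun V -> R^o} :=
  [ffun v => \sum_k c k 0 * ((head (O k) == val v)%:R - (tail (O k) == val v)%:R)].

Lemma boundary_is_linear : linear boundary.
Proof.
move=> a c d; apply/ffunP => v; rewrite !ffunE /GRing.scale /= mulr_sumr -big_split /=.
by apply: eq_bigr => k _; rewrite !mxE mulrDl mulrA.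
Qed.

HB.instance Definition _ :=
  GRing.isLinear.Build R 'cV[R]_m {ffun V -> R^o} *:%R boundary boundary_is_linear.

Definition H1 : {vspace 'cV[R]_m} := lker (linfun boundary).

Definition edge_form (c d : 'cV[R]_m) : R :=
  \sum_k edge_length (O k) * c k 0 * d k 0.

Lemma edge_form_bilinear : bilinear_for *%R (idfun \; *%R) edge_form.
Proof.
split=> c a d e; rewrite /edge_form /= mulr_sumr -big_split /=;
  apply: eq_bigr => k _; rewrite !mxE.
- by rewrite mulrDr mulrDl (mulrCA _ a) !mulrA.
- by rewrite mulrDr (mulrCA _ a).
Qed.

HB.instance Definition _ := bilinear_isBilinear.Build R 'cV[R]_m 'cV[R]_m R
  *%R (idfun \; *%R) edge_form edge_form_bilinear.

Lemma edge_form_sym c d : edge_form c d = (-1) ^+ false * idfun (edge_form d c).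
Proof.
rewrite expr0 mul1r /edge_form /=; apply: eq_bigr => k _.
by rewrite -!mulrA [c k 0 * _]mulrC.
Qed.

HB.instance Definition _ := isHermitianSesquilinear.Build R 'cV[R]_m false idfun
  edge_form edge_form_sym.

Definition H1perp : {vspace 'cV[R]_m} := orthov edge_form H1.

(* daddv_pi U W is the projection onto U along W. *)
Definition pi_H1 : 'End('cV[R]_m) := daddv_pi H1 H1perp.
Definition pi_H1perp : 'End('cV[R]_m) := daddv_pi H1perp H1.

Definition cross_ratio_mx (q : T) : 'M[R]_m :=
  \matrix_(i, j) cross_ratio q (tail (O i)) (head (O i)) (tail (O j)) (head (O j)).

Definition length_mx : 'M[R]_m := diag_mx (\row_i edge_length (O i)).

End Chains.

(* Matrix of f in the basis delta_mx k 0: column j holds the coordinates of the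
   image of the j-th basis vector. *)
Definition endo_mx (R : realType) (m : nat) (f : 'End('cV[R]_m)) : 'M[R]_m :=
  \matrix_(i, j) f (delta_mx j 0) i 0.

(* Main.v *)
Require Import Defs.
From mathcomp Require Import all_boot all_order all_algebra finmap.
From mathcomp Require Import all_classical all_reals all_analysis.
From mathcomp Require Import metric_structure sesquilinear lra ring.

(* Write g_j for the potential j_q(., f_j^+) - j_q(., f_j^-) of the edge f_j.
   The (i, j) entry of D^-1 Xi is the slope of g_j along the edge e_i: g_j is
   affine on every edge because it is piecewise affine with Laplacian supported
   on V. Hence column j of D^-1 Xi is the gradient of g_j, which is orthogonal
   to the cycles by summation by parts, and its boundary is
   Delta(g_j) = f_j^+ - f_j^-, so that it differs from f_j by a cycle.

   The metric input is that the star charts of T and the parametrizations of the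
   edges agree near each point: an edge leaving p runs along a single arm of the
   star at p, at unit speed. The existence of j_q(., y) for y in V comes from
   solving a discrete Poisson equation on V, q being allowed to lie in the
   interior of an edge. *)

Set Implicit Arguments.
Unset Strict Implicit.
Unset Printing Implicit Defensive.
Import Order.TTheory GRing.Theory Num.Theory.
Import numFieldNormedType.Exports.
Local Open Scope classical_set_scope.
Local Open Scope ring_scope.

(** * One-variable functions that are affine outside a finite set *)

Section AffineOnIntervals.
Context {R : realType}.
Implicit Types (G : R -> R) (a b s t e u : R).

(** Two distances compete: star charts are isometric for the ambient distance, edges for the path
    metric of their closure, and a shortcut outside an edge can make the former smaller. Only germs
    can be compared. [directions] records the outcome as a finite set of pairs (edge, sense) that
    depends on no star chart, so the Laplacian, which is defined through an unspecified chart,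
    becomes a sum over edges.

    A single potential may break at q inside an edge. In the difference of two potentials with the
    same q the masses at q cancel, and the other masses sit at vertices; so at each interior point
    the two outgoing slopes are opposite, and every possible break point there disappears.

    [jfun] is a choice with the zero function as default, hence the need for existence. In the
    Poisson equation the right-hand side has total mass zero, that is, it kills the constants;
    connectedness of the metric graph makes the constants the whole kernel of the gradient. *)

Definition locally_affine G s : Prop :=
  exists a e, 0 < e /\ forall t, `|t - s| < e -> G t = G s + a * (t - s).

(** The derivative of G exists and has derivative zero on the interval; the mean value theorem,
    applied to the derivative and then to G, makes the slope global. *)
Lemma locally_affine_itv G a b :
  (forall s, s \in `]a, b[ -> locally_affine G s) ->
  exists c, forall s t, s \in `]a, b[ -> t \in `]a, b[ -> G t - G s = c * (t - s).
Proof.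
move=> Gaff.
have nbhs_lt (s e : R) (P : R -> Prop) : 0 < e ->
    (forall t, `|t - s| < e -> P t) -> \forall t \near s, P t.
  move=> e0 HP; exists e => //= t st; apply: HP; by rewrite distrC.
have derG s c e : 0 < e -> (forall t, `|t - s| < e -> G t = G s + c * (t - s)) ->
    is_derive s (1 : R) G c.
  move=> e0 Ge; apply: (@near_eq_is_derive _ _ _ (fun t => G s + c * (t - s))).
  - apply: (nbhs_lt _ _ _ e0) => t te; exact/esym/Ge.
  - apply/is_derive1_caratheodory; exists (cst c); split => // [z|].
      by rewrite subrr mulr0 addr0 addrC addKr.
    exact: cst_continuous.
have derG1 s c e : 0 < e -> (forall t, `|t - s| < e -> G t = G s + c * (t - s)) ->
    derive1 G s = c.
  by move=> e0 /(derG _ _ _ e0) h; rewrite derive1E derive_val.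
have derG' s : s \in `]a, b[ -> is_derive s (1 : R) G (derive1 G s).
  move=> /Gaff[c [e [e0 Ge]]]; rewrite (derG1 s c e) //; exact: derG Ge.
have derG'' s : s \in `]a, b[ -> is_derive s (1 : R) (derive1 G) 0.
  move=> /Gaff[c [e [e0 Ge]]].
  apply: (@near_eq_is_derive _ _ _ (cst c)).
  apply: (nbhs_lt _ _ _ e0) => t te; apply/esym; apply: (derG1 t c (e - `|t - s|)).
      by rewrite subr_gt0.
    move=> u ut; rewrite (Ge t) // (Ge u); first by ring.
    by rewrite (le_lt_trans (ler_distD t _ _)) // -ltrBrDr.
have [D [GD D0]] : exists D : R -> R,
    (forall s, s \in `]a, b[ -> is_derive s (1 : R) G (D s)) /\
    (forall s, s \in `]a, b[ -> is_derive s (1 : R) D 0).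
  by exists (derive1 G).
move=> {derG derG1 derG' derG''}.
have mvt (f df : R -> R) (s t : R) :
    (forall s, s \in `]a, b[ -> is_derive s (1 : R) f (df s)) ->
    s \in `]a, b[ -> t \in `]a, b[ -> s <= t ->
    exists2 c, c \in `]a, b[ & f t - f s = df c * (t - s).
  move=> fdf sab tab st.
  have sub x : x \in `[s, t] -> x \in `]a, b[.
    by move: sab tab; rewrite !in_itv /=; lra.
  have dfst x : x \in `]s, t[ -> is_derive x (1 : R) f (df x).
    by move=> xst; apply/fdf/sub; apply: subset_itv_oo_cc.
  have cf : {within `[s, t], continuous f}.
    by apply: derivable_within_continuous => x /sub/fdf[].
  by have [c cst E] := MVT_segment st dfst cf; exists c => //; exact: sub.
have {mvt} main s t : s \in `]a, b[ -> t \in `]a, b[ -> s <= t ->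
    D t = D s /\ G t - G s = D s * (t - s).
  move=> sab tab st.
  have Dcst u v : u \in `]a, b[ -> v \in `]a, b[ -> u <= v -> D v = D u.
    move=> uab vab uv.
    have [c _] := mvt D (fun=> 0) u v D0 uab vab uv.
    by rewrite mul0r => /eqP; rewrite subr_eq0 => /eqP.
  split; first exact: Dcst.
  have [c cab ->] := mvt G D s t GD sab tab st; congr (_ * _).
  by case: (leP c s) => [/Dcst|/ltW/Dcst] ->.
case: (pselect (exists s, s \in `]a, b[)) => [[s0 s0ab]|no]; last first.
  by exists 0 => s t sab; case: no; exists s.
have Dcst s : s \in `]a, b[ -> D s = D s0.
  by move=> sab; case: (leP s s0) => [/main|/ltW/main] [] // ->.
exists (D s0) => s t sab tab; case: (leP s t) => [st|/ltW ts].
  by rewrite (main s t _ _ st).2 // Dcst.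
by apply: oppr_inj; rewrite opprB (main t s _ _ ts).2 // Dcst // -mulrN opprB.
Qed.

Lemma near_at_right0 (P : R -> Prop) e :
  0 < e -> (forall t, 0 < t < e -> P t) -> \forall t \near 0^'+, P t.
Proof.
move=> e0 HP; exists e => //= t /=; rewrite sub0r normrN => te t0.
by apply: HP; rewrite t0 /= -(gtr0_norm t0).
Qed.

Lemma cvg_at_right0_ext (f g : R -> R) (l e : R) : 0 < e ->
  (forall t, 0 < t < e -> f t = g t) ->
  f t @[t --> 0^'+] --> l -> g t @[t --> 0^'+] --> l.
Proof.
by move=> e0 fg; apply: cvg_trans; apply: near_eq_cvg; exact: near_at_right0 fg.
Qed.

(* Both slopes are outgoing: G is differentiable at s when they are opposite. *)
Definition right_slope G s a := (G (s + t) - G s) / t @[t --> 0^'+] --> a.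
Definition left_slope G s a := (G (s - t) - G s) / t @[t --> 0^'+] --> a.

(** G is affine to the right of s with some slope c, possibly with a jump k at s. Convergence of the
    difference quotient at s forces both k = 0 and c = a. *)
Lemma right_slope_affine G s e a : 0 < e ->
  (forall u, u \in `]s, s + e[ -> locally_affine G u) -> right_slope G s a ->
  forall t, 0 <= t < e -> G (s + t) = G s + a * t.
Proof.
move=> e0 Gaff sl.
have [c Gc] := locally_affine_itv Gaff.
pose k := G (s + e / 2) - c * (e / 2) - G s.
have Gk t : 0 < t < e -> G (s + t) - G s = k + c * t.
  move=> te; rewrite /k -[G (s + t)](subrK (G (s + e / 2))) Gc; first ring.
    by rewrite in_itv /=; lra.
  by rewrite in_itv /=; lra.
have k0 : k = 0.
  have : (k + c * t) @[t --> 0^'+] --> (0 : R).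
    have id0 : (t : R) @[t --> 0^'+] --> (0 : R).
      by apply: cvg_at_right_filter; exact: cvg_id.
    have h := @cvgM _ _ _ (at_right_proper_filter (0 : R)) _ _ _ _ id0 sl.
    rewrite mul0r in h.
    refine (@cvg_at_right0_ext (fun t => t * ((G (s + t) - G s) / t))
      _ _ _ e0 _ h) => t te.
    rewrite -Gk // mulrC divfK // gt_eqF //; lra.
  have : (k + c * t) @[t --> 0^'+] --> (k + c * 0).
    apply: cvgD; first exact: cvg_cst.
    by apply: cvgM; [exact: cvg_cst|apply: cvg_at_right_filter; exact: cvg_id].
  by rewrite mulr0 addr0; apply: cvg_unique.
have ca : c = a.
  have : (fun=> c) t @[t --> (0 : R)^'+] --> a.
    refine (cvg_at_right0_ext e0 _ sl) => t te.
    rewrite Gk // k0 add0r mulfK // gt_eqF //; lra.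
  apply: cvg_unique => //; exact: cvg_cst.
move=> t /andP[]; rewrite le_eqVlt => /predU1P[<- _|t0 te].
  by rewrite addr0 mulr0 addr0.
by rewrite -ca -[LHS](subrK (G s)) Gk ?t0 // k0 add0r addrC.
Qed.

Lemma left_slope_affine G s e a : 0 < e ->
  (forall u, u \in `]s - e, s[ -> locally_affine G u) -> left_slope G s a ->
  forall t, 0 <= t < e -> G (s - t) = G s + a * t.
Proof.
move=> e0 Gaff sl t te.
have -> : G (s - t) = (G \o -%R) (- s + t) by rewrite /= opprD opprK.
have -> : G s = (G \o -%R) (- s) by rewrite /= opprK.
apply: right_slope_affine te => // [u ue|].
  have [|c [d [d0 Gd]]] := Gaff (- u).
    by move: ue; rewrite !in_itv /=; lra.
  exists (- c), d; split => // x xd /=; rewrite Gd; first by ring.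
  by rewrite -opprD normrN.
rewrite /right_slope /= opprK.
by under eq_fun do rewrite opprD opprK.
Qed.

(** Opposite outgoing slopes remove the break points in S, so G is affine on the open interval; the
    one-sided slopes at 0 and L extend this to the ends. *)
Lemma piecewise_affine_slopes G L (S : set R) (ar al : R -> R) :
  0 < L -> finite_set S ->
  (forall s, 0 < s < L -> ~ S s -> locally_affine G s) ->
  (forall s, 0 <= s < L -> right_slope G s (ar s)) ->
  (forall s, 0 < s <= L -> left_slope G s (al s)) ->
  (forall s, 0 < s < L -> ar s + al s = 0) ->
  ar 0 = (G L - G 0) / L /\ al L = - ((G L - G 0) / L).
Proof.
move=> L0 finS GS Gr Gl Grl.
have {}GS s : 0 < s < L -> locally_affine G s.
  move=> s0L.
  (* A finite set is closed, so some punctured neighborhood of s avoids S. *)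
  have finS' : finite_set (S `\ s) by apply: finite_setD.
  have cl : closed (S `\ s).
    exact: (accessible_finite_set_closed.1 (hausdorff_accessible (@Rhausdorff R))).
  have : open (~` (S `\ s)) by rewrite openC.
  rewrite openE => /(_ s)[|e /= e0 es]; first by move=> [_ /(_ erefl)].
  have e'0 : 0 < Num.min e (Num.min s (L - s)).
    by rewrite !lt_min e0 /=; lra.
  set e' := Num.min e _ in e'0.
  have [e'e e's e'Ls] : [/\ e' <= e, e' <= s & e' <= L - s].
    by rewrite /e' !ge_min !lexx !orbT.
  have aff u : u != s -> `|s - u| < e' -> locally_affine G u.
    move=> us sue; apply: GS.
      by move: sue; rewrite ltr_norml; lra.
    move=> Su; apply: (es u) => //=.
      exact: lt_le_trans sue e'e.
    by split => //; apply/eqP.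
  exists (ar s), e'; split => // t te.
  case: (leP s t) => [st|ts].
    have -> : t = s + (t - s) by rewrite addrC subrK.
    rewrite (@right_slope_affine G s e' (ar s)) //; first by congr (_ + _ * _); ring.
    - move=> u; rewrite in_itv /= => ue; apply: aff; first by rewrite gt_eqF //; lra.
      by rewrite ltr_norml; lra.
    - by apply: Gr; lra.
    - by move: te; rewrite ltr_norml; lra.
  have -> : t = s - (s - t) by rewrite opprB addrC subrK.
  rewrite (@left_slope_affine G s e' (al s)) //.
  - have -> : al s = - ar s by have := Grl s s0L; lra.
    by ring.
  - move=> u; rewrite in_itv /= => ue; apply: aff; first by rewrite lt_eqF //; lra.
    by rewrite ltr_norml; lra.
  - by apply: Gl; lra.
  - by move: te; rewrite ltr_norml; lra.
have Rgt : forall t, 0 <= t < L -> G (0 + t) = G 0 + ar 0 * t.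
  apply: right_slope_affine => //; last by apply: Gr; rewrite lexx.
  by move=> u; rewrite in_itv /= add0r => /GS.
have Lft : forall t, 0 <= t < L -> G (L - t) = G L + al L * t.
  apply: left_slope_affine => //; last by apply: Gl; rewrite lexx L0.
  by move=> u; rewrite in_itv /= subrr => /GS.
(* Each expansion misses the opposite end, so the two are compared at two interior points, which
   determine both slopes. *)
have h1 := Rgt (L / 2); have h2 := Rgt (L / 4).
have h3 := Lft (L / 2); have h4 := Lft (L / 4 * 3).
rewrite !add0r in h1 h2.
have e1 : L - L / 2 = L / 2 by field.
have e2 : L - L / 4 * 3 = L / 4 by field.
rewrite e1 in h3; rewrite e2 in h4.
have {}h1 : G (L / 2) = G 0 + ar 0 * (L / 2) by apply: h1; lra.
have {}h2 : G (L / 4) = G 0 + ar 0 * (L / 4) by apply: h2; lra.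
have {}h3 : G (L / 2) = G L + al L * (L / 2) by apply: h3; lra.
have {}h4 : G (L / 4) = G L + al L * (L / 4 * 3) by apply: h4; lra.
have Ln0 : L != 0 by rewrite gt_eqF.
have k1 : G L - G 0 = ar 0 * L.
  nra.
have k2 : al L * L = - (ar 0 * L) by nra.
rewrite k1 mulfK //; split => //.
by apply: (mulIf Ln0); rewrite k2 mulNr.
Qed.

End AffineOnIntervals.

(** * Lipschitz maps on a segment *)

Section Lipschitz.
Context {R : realType}.

Lemma lipschitz_within_continuous (U : pseudoMetricType R) (g : R -> U) (K a b : R) :
  0 <= K ->
  (forall s t e, s \in `[a, b] -> t \in `[a, b] -> K * `|s - t| < e ->
     ball (g s) e (g t)) ->
  {within `[a, b], continuous g}.
Proof.
move=> K0 gK; apply/subspace_continuousP => s sab.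
apply/cvg_ballP => e e0; rewrite near_withinE.
(* K may be 0, hence K + 1 in the denominator. *)
have K1 : 0 < K + 1 by rewrite ltr_wpDl.
exists (e / (K + 1)); first by rewrite /= divr_gt0.
move=> t /= st tab; apply: gK => //.
apply: le_lt_trans (_ : (K + 1) * `|s - t| < e).
  by rewrite ler_wpM2r // lerDl.
by rewrite mulrC -ltr_pdivlMr.
Qed.

Lemma lipschitz_IVT (h : R -> R) (a b v : R) : a <= b ->
  (forall s t, s \in `[a, b] -> t \in `[a, b] -> `|h s - h t| <= `|s - t|) ->
  Num.min (h a) (h b) <= v <= Num.max (h a) (h b) ->
  exists2 c, c \in `[a, b] & h c = v.
Proof.
move=> ab hl; apply: IVT => //.
apply: (@lipschitz_within_continuous _ _ 1) => // s t e sab tab.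
by rewrite mul1r -ball_normE /=; apply: le_lt_trans; exact: hl.
Qed.

End Lipschitz.

(** * Arcs, path distances and germs of arcs in a star *)

Section Arcs.
Context {R : realType} {T : metricType R}.
Implicit Types (A : set T) (g phi : R -> T) (x y p : T).

Lemma path_dist_ge A x y : ((mdist x y)%:E <= path_dist A x y)%E.
Proof.
apply: le_ereal_inf_tmp => _ [g [_ _ <- <-] <-].
apply: ereal_sup_ubound; exists [:: 1].
  by apply: itv_partition1; rewrite ltr01.
by rewrite /= big_nat1.
Qed.

Lemma path_length_const_speed g (c : R) :
  (forall s t, s \in `[0, 1] -> t \in `[0, 1] ->
     mdist (g s) (g t) = c * `|s - t|) ->
  (path_length g <= c%:E)%E.
Proof.
move=> gc; apply: ge_ereal_sup => _ [s s01 <-]; rewrite lee_fin.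
have s_in i : (i < (size s).+1)%N -> nth 1 (0 :: s) i \in `[0, 1].
  move=> is_; rewrite in_itv /=; apply/andP; split.
    exact: itv_partition_nth_ge is_ s01.
  exact: itv_partition_nth_le is_ s01.
rewrite (eq_big_nat _ _ (F2 := fun i =>
    c * nth 1 (0 :: s) i.+1 - c * nth 1 (0 :: s) i)).
  rewrite telescope_sumr //= -[X in nth _ _ X]/(size (0 :: s)).-1 nth_last.
  by have [_ /eqP /= ->] := s01; rewrite mulr0 subr0 mulr1.
move=> i /andP[_ i_s]; rewrite gc ?s_in ?ltnS ?(ltnW i_s) //.
rewrite -mulrBr distrC ger0_norm // subr_ge0.
by case: s01 => /(pathP 1)/(_ i i_s)/ltW.
Qed.

(** Source of upper bounds on [path_dist]: exhibit a path inside A. It serves for constant paths and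
    for segments of a star arm. *)
Lemma path_dist_const_speed A g (c : R) : 0 <= c ->
  (forall s, s \in `[0, 1] -> A (g s)) ->
  (forall s t, s \in `[0, 1] -> t \in `[0, 1] ->
     mdist (g s) (g t) = c * `|s - t|) ->
  (path_dist A (g 0%R) (g 1%R) <= c%:E)%E.
Proof.
move=> c0 gA gc; apply: le_trans (path_length_const_speed gc).
apply: ereal_inf_lbound; exists g => //; split=> //; last first.
  by move=> _ [s s01 <-]; exact: gA.
apply: (@lipschitz_within_continuous _ _ _ c) => // s t e s01 t01 ste.
by rewrite ballEmdist /= gc.
Qed.

Lemma arc_lipschitz A L phi s t : arc_parametrization A L phi ->
  s \in `[0, L] -> t \in `[0, L] -> mdist (phi s) (phi t) <= `|s - t|.
Proof.
move=> [_ _ iso] sL tL; rewrite -lee_fin -(iso s t sL tL).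
exact: path_dist_ge.
Qed.

(** If phi s = phi t, the constant path stays in A and bounds their path distance, which is |s - t|,
    by 0. *)
Lemma arc_inj A L phi s t : arc_parametrization A L phi ->
  s \in `[0, L] -> t \in `[0, L] -> phi s = phi t -> s = t.
Proof.
move=> [_ imA iso] sL tL E; apply/eqP; rewrite -subr_eq0 -normr_le0.
rewrite -lee_fin -(iso s t sL tL) E.
apply: (@path_dist_const_speed A (fun=> phi t) 0) => // [u _|u v _ _].
  by rewrite -imA; exists t.
by rewrite mdistxx mul0r.
Qed.

Lemma arc_continuous A L phi : arc_parametrization A L phi ->
  {within `[0, L], continuous phi}.
Proof.
move=> phiA; apply: (@lipschitz_within_continuous _ _ _ 1) => // s t e sL tL.
by rewrite mul1r ballEmdist /=; apply: le_lt_trans; exact: arc_lipschitz phiA _ _.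
Qed.

Lemma arc_rev A L phi : arc_parametrization A L phi ->
  arc_parametrization A L (fun t => phi (L - t)).
Proof.
have flip t : t \in `[0, L] -> L - t \in `[0, L] by rewrite !in_itv /=; lra.
move=> [L0 imA iso]; split => // [|s t sL tL].
  rewrite -imA; apply/seteqP; split => [_ [t tL <-]|_ [t tL <-]].
    by exists (L - t) => //; exact: flip.
  by exists (L - t); [exact: flip|rewrite subKr].
by rewrite iso ?flip // opprB addrC addrA subrK distrC.
Qed.

Section Stars.
Variables (p : T) (n : nat) (r : R) (psi : 'I_n -> R -> T).
Hypothesis psiP : star_chart p r psi.

Lemma star_gt0 : 0 < r. Proof. by case: psiP. Qed.

Lemma star_centre k : psi k 0 = p. Proof. by case: psiP. Qed.

Lemma star_distE k l s t : 0 <= s < r -> 0 <= t < r ->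
  mdist (psi k s) (psi l t) = if k == l then `|s - t| else s + t.
Proof. by move=> sr tr; case: psiP => _ _ -> //; rewrite in_itv. Qed.

Lemma star_dist_centre k t : 0 <= t < r -> mdist p (psi k t) = t.
Proof.
move=> tr; rewrite -(star_centre k) star_distE ?lexx ?star_gt0 // eqxx.
by rewrite sub0r normrN ger0_norm //; case/andP: tr.
Qed.

Lemma star_inj k l s t : 0 < s < r -> 0 <= t < r -> psi k s = psi l t ->
  k = l /\ s = t.
Proof.
move=> /andP[s0 sr] tr E; have sr' : 0 <= s < r by rewrite ltW.
have st : s = t by rewrite -(star_dist_centre k sr') E star_dist_centre.
split => //; apply/eqP; apply: contraT => kl.
have := star_distE k l sr' tr; rewrite E mdistxx (negbTE kl); lra.
Qed.

Lemma star_nbhs : exists2 d, 0 < d &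
  forall x, mdist p x < d -> exists k t, 0 <= t < r /\ x = psi k t.
Proof.
case: psiP => _ _ _ /nbhs_ballP[d d0 pd]; exists d => // x xd.
have [|k [t [tr ->]]] := pd x; first by rewrite ballEmdist.
by exists k, t; rewrite in_itv /= in tr.
Qed.

(** The arc enters a single arm; it remains to see that its distance to p grows at unit speed. The
    ambient distance is at most the path distance, which bounds the radius at time t by t; the
    reverse bound needs a path inside A. *)
Lemma arc_germ A L phi s : arc_parametrization A L phi ->
  0 <= s < L -> phi s = p ->
  exists k e, [/\ 0 < e, e <= r, s + e <= L &
    forall t, 0 <= t < e -> phi (s + t) = psi k t].
Proof.
move=> phiA /andP[s0 sL] phis.
have [d d0 pd] := star_nbhs; have r0 := star_gt0.
pose e := Num.min d (Num.min r (L - s)).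
have e0 : 0 < e by rewrite !lt_min d0 r0 subr_gt0.
have [ed er eL] : [/\ e <= d, e <= r & e <= L - s].
  by rewrite /e !ge_min !lexx !orbT.
have in0L t : 0 <= t < e -> s + t \in `[0, L] by rewrite in_itv /=; lra.
have lip t t' : 0 <= t < e -> 0 <= t' < e ->
    mdist (phi (s + t)) (phi (s + t')) <= `|t - t'|.
  move=> te te'; apply: le_trans (arc_lipschitz phiA (in0L _ te) (in0L _ te')) _.
  by rewrite opprD addrACA subrr add0r.
have dist_p t : 0 <= t < e -> mdist p (phi (s + t)) <= t.
  move=> te; have := lip 0 t; rewrite addr0 phis => /(_ _ te); rewrite lexx e0.
  by move=> /(_ isT)/le_trans; apply; rewrite sub0r normrN ger0_norm; lra.
(* The chart covers p itself, so the star has an arm; it serves as the default value of the choice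
   below. *)
have [k1 _] : exists k : 'I_n, True.
  by have [|k _] := pd p; [rewrite mdistxx|exists k].
have /choice[F FP] : forall t, exists F : 'I_n * R, 0 <= t < e ->
    0 <= F.2 < r /\ phi (s + t) = psi F.1 F.2.
  move=> t; case: (pselect (0 <= t < e)) => [te|]; last by exists (k1, 0).
  have [|k [u ku]] := pd (phi (s + t)).
    by apply: (le_lt_trans (dist_p t te)); lra.
  by exists (k, u).
have UE t : 0 <= t < e -> (F t).2 = mdist p (phi (s + t)).
  by move=> /FP[Fr ->]; rewrite star_dist_centre.
have U0 t : 0 < t < e -> 0 < (F t).2.
  move=> te; have te' : 0 <= t < e by lra.
  rewrite UE // mdist_gt0; apply/eqP; rewrite -phis => E.
  have := arc_inj phiA _ (in0L _ te') E; rewrite in_itv /= => H.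
  by have := H ltac:(lra); lra.
have U_lip t t' : 0 <= t < e -> 0 <= t' < e -> `|(F t).2 - (F t').2| <= `|t - t'|.
  move=> te te'; apply: le_trans (lip t t' te te').
  rewrite !UE // ler_norml.
  have := metric_triangle p (phi (s + t)) (phi (s + t')).
  have := metric_triangle p (phi (s + t')) (phi (s + t)).
  by rewrite (metric_sym (phi (s + t'))); lra.
pose k0 := (F (e / 2)).1.
(* h is 1-Lipschitz and vanishes only at 0, so phi cannot change arms. *)
pose h t := if (F t).1 == k0 then (F t).2 else - (F t).2.
have h_lip t t' : 0 <= t < e -> 0 <= t' < e -> `|h t - h t'| <= `|t - t'|.
  move=> te te'; have := lip t t' te te'; have := U_lip t t' te te'.
  have [Ur ->] := FP t te; have [Ur' ->] := FP t' te'.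
  rewrite star_distE // /h; case: (eqVneq (F t).1 (F t').1) => [->|ne].
    by case: ifP => // _ H _; rewrite -opprD normrN.
  case: eqP => [tk|_]; case: eqP => [tk'|_].
  - by case/eqP: ne; rewrite tk tk'.
  - by move=> _ H; rewrite opprK ger0_norm //; lra.
  - by move=> _ H; rewrite ler0_norm; [rewrite opprD !opprK|lra].
  - by move=> H _; rewrite -opprD normrN.
have karm t : 0 < t < e -> (F t).1 = k0.
  move=> te; apply/eqP/negPn/negP => tk.
  have e2 : 0 < e / 2 < e by lra.
  have ht : h t < 0 by rewrite /h (negbTE tk) oppr_lt0 U0.
  have he : 0 < h (e / 2) by rewrite /h eqxx U0.
  have [c cI hc] : exists2 c, 0 < c < e & h c = 0.
    case: (leP t (e / 2)) => [le|/ltW le].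
      have [x xI hx] : exists2 c, c \in `[t, e / 2] & h c = 0.
        apply: lipschitz_IVT => // [x y|].
          by rewrite !in_itv /= => xI yI; apply: h_lip; lra.
        by rewrite ge_min le_max (ltW ht) (ltW he) orbT.
      by exists x => //; move: xI; rewrite in_itv /=; lra.
    have [x xI hx] : exists2 c, c \in `[e / 2, t] & h c = 0.
      apply: lipschitz_IVT => // [x y|].
        by rewrite !in_itv /= => xI yI; apply: h_lip; lra.
      by rewrite ge_min le_max (ltW ht) (ltW he) orbT.
    by exists x => //; move: xI; rewrite in_itv /=; lra.
  have := U0 c cI; move: hc; rewrite /h; case: ifP => _; lra.
have phiE t : 0 <= t < e -> phi (s + t) = psi k0 (F t).2.
  move=> te; have [_ ->] := FP t te; have [t0|t0] := eqVneq t 0.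
    have -> : (F t).2 = 0 by rewrite UE // t0 addr0 phis mdistxx.
    by rewrite !star_centre.
  by rewrite karm // [0 < t]lt_neqAle eq_sym t0.
exists k0, e; split => // [|t te]; first by lra.
rewrite phiE //; congr (psi k0 _); apply/le_anti/andP; split.
  by rewrite UE // dist_p.
(* The arm from p to phi (s + t) is covered by phi, so its length bounds the
   distance t of its ends inside A. *)
have [Ur _] := FP t te.
have F0 : (F 0).2 = 0 by rewrite UE ?lexx // addr0 phis mdistxx.
case: (phiA) => _ imA iso.
have st : `|s - (s + t)| = t.
  by rewrite opprD addrA subrr sub0r normrN ger0_norm; lra.
suff: `|s - (s + t)| <= (F t).2 by rewrite st.
rewrite -lee_fin -iso ?in0L //; last by rewrite in_itv /=; lra.
have -> : phi s = psi k0 (0 * (F t).2) by rewrite mul0r star_centre.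
have -> : phi (s + t) = psi k0 (1 * (F t).2) by rewrite mul1r phiE.
apply: (@path_dist_const_speed A (fun u => psi k0 (u * (F t).2))); first by lra.
- move=> x; rewrite in_itv /= => x01; rewrite -imA.
  have [c cI <-] : exists2 c, c \in `[0, t] & (F c).2 = x * (F t).2.
    apply: (@lipschitz_IVT _ (fun u => (F u).2)); first by lra.
      by move=> y z; rewrite !in_itv /= => yI zI; apply: U_lip; lra.
    rewrite F0 ge_min le_max; apply/andP; split; apply/orP; [left|right].
      by apply: mulr_ge0; lra.
    by rewrite ler_piMl; lra.
  move: cI; rewrite in_itv /= => cI.
  by exists (s + c); [apply: in0L|apply: phiE]; lra.
- move=> x y; rewrite !in_itv /= => x01 y01.
  have inr z : 0 <= z <= 1 -> 0 <= z * (F t).2 < r.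
    move=> z01; apply/andP; split; first by apply: mulr_ge0; lra.
    by apply: le_lt_trans (_ : (F t).2 < r); [rewrite ler_piMl; lra|lra].
  rewrite star_distE ?inr // eqxx -mulrBl normrM mulrC ger0_norm //; lra.
Qed.

End Stars.
End Arcs.

(** * Topology of an arc and of its interior *)

Section ArcTopology.
Context {R : realType} {T : metricType R} (A : set T) (L : R) (phi : R -> T).
Hypothesis phiA : arc_parametrization A L phi.

Lemma arc_image_closed a b : 0 <= a -> b <= L -> closed (phi @` `[a, b]).
Proof.
move=> a0 bL; apply: (compact_closed (@metric_hausdorff _ T)).
apply: continuous_compact; last exact: segment_compact.
apply: continuous_subspaceW (arc_continuous phiA) => t /=.
by rewrite !in_itv /=; lra.
Qed.

(** The parameters at distance at least e from s have a compact image, which misses phi s by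
    injectivity and so lies at positive distance from it. *)
Lemma arc_inverse_continuous s e : s \in `[0, L] -> 0 < e ->
  exists2 d, 0 < d & forall t, t \in `[0, L] -> mdist (phi s) (phi t) < d ->
    `|t - s| < e.
Proof.
move=> sL e0; move: (sL); rewrite in_itv /= => sL'.
pose K := phi @` `[0, s - e] `|` phi @` `[s + e, L].
have clK : closed K.
  by apply: closedU; apply: arc_image_closed; lra.
have opK : open (~` K) by rewrite openC.
have /nbhs_ballP[d /= d0 dK] : nbhs (phi s) (~` K).
  apply: open_nbhs_nbhs; split => // -[] [t /=]; rewrite in_itv /= => ts E.
    have := arc_inj phiA _ sL E; rewrite in_itv /= => H.
    by have := H ltac:(lra); lra.
  have := arc_inj phiA _ sL E; rewrite in_itv /= => H.
  by have := H ltac:(lra); lra.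
exists d => // t tL td; rewrite ltNge; apply/negP => ets.
apply: (dK (phi t)); first by rewrite ballEmdist.
move: tL; rewrite in_itv /= => tL.
case: (leP s t) ets => st.
  rewrite ger0_norm ?subr_ge0 // => ets; right; exists t => //=.
  by rewrite in_itv /=; lra.
rewrite ltr0_norm ?subr_lt0 // => ets; left; exists t => //=.
by rewrite in_itv /=; lra.
Qed.

(** If C missed phi s, the images of [0, s] and [s, L] would cut C into two relatively clopen
    pieces. By connectedness C, hence its closure A, would lie in one of these images, which omits
    an end of the arc. *)
Lemma arc_connected_interior (C : set T) s : closure C = A -> connected C ->
  ~ C (phi 0) -> ~ C (phi L) -> 0 < s < L -> C (phi s).
Proof.
move=> clC Ccon C0 CL sL; apply: contrapT => Cs.
have imA : phi @` `[0, L] = A by case: phiA.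
have CA x : C x -> exists2 t, (t \in `[0, L]) && (t != s) & phi t = x.
  move=> Cx; have : A x by rewrite -clC; exact: subset_closure.
  rewrite -imA => -[t /= tL tx]; exists t => //; rewrite tL /=.
  by apply/eqP => ts; apply: Cs; rewrite -ts tx.
have sin : s \in `[0, L] by rewrite in_itv /=; lra.
have inj t u : 0 <= t <= L -> 0 <= u <= L -> phi t = phi u -> t = u.
  by move=> tL uL; apply: (arc_inj phiA); rewrite in_itv.
have halves t : 0 <= t <= L -> C (phi t) -> ~ (phi @` `[0, s]) (phi t) ->
    (phi @` `[s, L]) (phi t).
  move=> tL Ct nt; exists t => //=; rewrite in_itv /=; apply/andP; split; last lra.
  rewrite leNgt; apply/negP => ts; apply: nt; exists t => //=; rewrite in_itv /=; lra.
have eqB : C `&` phi @` `[0, s] = C `&` ~` (phi @` `[s, L]).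
  apply/seteqP; split => x [Cx].
    move=> [t /=]; rewrite in_itv /= => ts tx; split => // -[u /=].
    rewrite in_itv /= => us; rewrite -tx => /(inj u t) E.
    have ut : u = t by apply: E; lra.
    by apply: Cs; have <- : t = s; [lra|rewrite tx].
  move=> nx; split => //; apply: contrapT => nx'; apply: nx.
  have [t /andP[]] := CA x Cx; rewrite in_itv /= => tL _ E.
  by rewrite -E; apply: halves => //; rewrite E.
have [B0|B0] := pselect ((C `&` phi @` `[0, s]) !=set0).
  have BC : C `&` phi @` `[0, s] = C.
    apply: Ccon => //.
      by exists (~` (phi @` `[s, L])) => //; rewrite openC; apply: arc_image_closed; lra.
    by exists (phi @` `[0, s]) => //; apply: arc_image_closed; lra.
  have : A `<=` phi @` `[0, s].
    rewrite -clC (iffLR (closure_id (phi @` `[0, s])));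
      last by apply: arc_image_closed; lra.
    by apply: closureS; rewrite -BC => x [].
  rewrite -imA => /(_ (phi L)) [|t /=].
    by exists L => //=; rewrite in_itv /=; lra.
  rewrite in_itv /= => ts /(inj t L) E.
  by have : t = L by [apply: E; lra]; lra.
have : A `<=` phi @` `[s, L].
  rewrite -clC (iffLR (closure_id (phi @` `[s, L])));
    last by apply: arc_image_closed; lra.
  apply: closureS => x Cx; have [t /andP[]] := CA x Cx; rewrite in_itv /= => tL _ E.
  rewrite -E; apply: halves => //; rewrite E // => nx; apply: B0; by exists x.
rewrite -imA => /(_ (phi 0)) [|t /=].
  by exists 0 => //=; rewrite in_itv /=; lra.
rewrite in_itv /= => ts /(inj t 0) E.
by have : t = 0 by [apply: E; lra]; lra.
Qed.

End ArcTopology.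

(** * Components of the complement of the vertex set *)

Section Components.
Context {R : realType} {T : metricType R} (V : set T).
Implicit Types (C D : set T) (x : T).

Lemma edge_sets_sub C : edge_sets V C -> C `<=` ~` V.
Proof. by move=> [x _ <-]; exact: connected_component_sub. Qed.

Lemma edge_sets_connected C : edge_sets V C -> connected C.
Proof. by move=> [x _ <-]; exact: component_connected. Qed.

Lemma edge_sets_eq C x : edge_sets V C -> C x -> connected_component (~` V) x = C.
Proof. by move=> [y _ <-] yx; apply/esym; exact: same_connected_component. Qed.

End Components.

Lemma finite_positive_lower_bound (R : realType) n (e : 'I_n -> R) :
  (forall k, 0 < e k) -> exists2 d, 0 < d & forall k, d <= e k.
Proof.
(* The initial value 1 gives a positive bound even when n = 0. *)
move=> e0; exists (\big[Num.min/1]_k e k); last by move=> k; exact: bigmin_le.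
by apply: lt_bigmin => //; exact: ltr01.
Qed.

(** * Edges of a model and directions at a point *)

Section Model.
Context {R : realType} {T : metricType R} (V : {fset T}) (m : nat).
Variables (O : 'I_m -> oriented_edge T) (L : 'I_m -> R) (phi : 'I_m -> R -> T).
Hypothesis hO : orientation [set` V] O.
Hypothesis phiP : forall i,
  [/\ arc_parametrization (closure (Defs.support (O i))) (L i) (phi i),
      phi i 0 = tail (O i) & phi i (L i) = Defs.head (O i)].
Implicit Types (p : T) (i : 'I_m) (d : 'I_m * bool) (f : T -> R).

Let arc i : arc_parametrization (closure (Defs.support (O i))) (L i) (phi i).
Proof. by case: (phiP i). Qed.

Lemma edge_tail i : phi i 0 = tail (O i). Proof. by case: (phiP i). Qed.
Lemma edge_head i : phi i (L i) = Defs.head (O i). Proof. by case: (phiP i). Qed.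
Lemma tail_vertex i : tail (O i) \in V. Proof. by case: hO => /(_ i)[]. Qed.
Lemma head_vertex i : Defs.head (O i) \in V. Proof. by case: hO => /(_ i)[]. Qed.

Lemma length_gt0 i : 0 < L i. Proof. by case: (arc i). Qed.

Lemma edge_lengthE i : edge_length (O i) = L i.
Proof.
have L0 := length_gt0 i; case: (arc i) => _ _ iso.
rewrite /edge_length -edge_tail -edge_head iso ?in_itv /= ?lexx ?(ltW L0) //.
by rewrite sub0r normrN ger0_norm // ltW.
Qed.

Lemma edge_inj i s t : 0 <= s <= L i -> 0 <= t <= L i -> phi i s = phi i t -> s = t.
Proof. by move=> sL tL; apply: (arc_inj (arc i)); rewrite in_itv. Qed.

Let support_edge i : edge_sets [set` V] (Defs.support (O i)).
Proof. by case: hO => /(_ i)[]. Qed.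

Lemma support_vertex i p : Defs.support (O i) p -> p \notin V.
Proof. by move=> ip; apply/negP; exact: edge_sets_sub (support_edge i) _ ip. Qed.

Lemma support_interior i s : 0 < s < L i -> Defs.support (O i) (phi i s).
Proof.
apply: (arc_connected_interior (arc i)) => //.
- exact: edge_sets_connected (support_edge i).
- by rewrite edge_tail => /support_vertex; rewrite tail_vertex.
- by rewrite edge_head => /support_vertex; rewrite head_vertex.
Qed.

Lemma closure_supportP i p : closure (Defs.support (O i)) p ->
  exists2 s, 0 <= s <= L i & phi i s = p.
Proof.
case: (arc i) => _ <- _ [s /=]; rewrite in_itv /= => sL sp; by exists s.
Qed.

Lemma supportP i p : Defs.support (O i) p -> exists2 s, 0 < s < L i & phi i s = p.
Proof.
move=> ip; have [s sL sp] := closure_supportP (subset_closure ip).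
exists s => //; have := support_vertex ip; rewrite -sp => sV.
have /eqP s0 : s != 0 by apply: contraNneq sV => ->; rewrite edge_tail tail_vertex.
have /eqP s1 : s != L i by apply: contraNneq sV => ->; rewrite edge_head head_vertex.
by rewrite !lt_neqAle; apply/andP; split; apply/andP; split; try lra; apply/eqP; lra.
Qed.

Lemma support_inj i j p : Defs.support (O i) p -> Defs.support (O j) p -> i = j.
Proof.
move=> ip jp; have [_ uniqO] := hO.
have [k [_ ku]] := uniqO _ (support_edge i).
rewrite -(ku i) //; apply: ku.
by rewrite -(edge_sets_eq (support_edge j) jp) (edge_sets_eq (support_edge i) ip).
Qed.

Lemma interior_notin i s : 0 < s < L i -> phi i s \notin V.
Proof. by move=> /support_interior/support_vertex. Qed.

(** An interior point is not a vertex, so t is interior as well, and two components sharing a point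
    coincide. *)
Lemma interior_inj i j s t : 0 < s < L i -> 0 <= t <= L j -> phi i s = phi j t ->
  i = j /\ s = t.
Proof.
move=> sL tL E; have sV := interior_notin sL.
have t0 : t != 0 by apply: contraNneq sV => t0; rewrite E t0 edge_tail tail_vertex.
have t1 : t != L j by apply: contraNneq sV => t1; rewrite E t1 edge_head head_vertex.
have tL' : 0 < t < L j.
  by rewrite !lt_neqAle t1 eq_sym t0.
have ij : i = j.
  by apply: support_inj (support_interior sL) _; rewrite E; exact: support_interior.
split => //; subst j; apply: edge_inj E => //; lra.
Qed.

Lemma edge_notin_interior i s : 0 <= s <= L i -> phi i s \notin V -> 0 < s < L i.
Proof.
move=> sL sV; rewrite !lt_neqAle; apply/andP; split; apply/andP; split; try lra.
  by apply: contraNneq sV => <-; rewrite edge_tail tail_vertex.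
by apply: contraNneq sV => ->; rewrite edge_head head_vertex.
Qed.

(* Junk value 0 if p is not on the i-th closed edge. *)
Definition edge_pos i p : R := xget 0 [set s | 0 <= s <= L i /\ phi i s = p].

Lemma edge_posE i s : 0 <= s <= L i -> edge_pos i (phi i s) = s.
Proof.
move=> sL; rewrite /edge_pos; case: xgetP => [t _ [tL E]|/(_ s)]; last by case.
exact: edge_inj tL sL E.
Qed.

(* Directions in which one can leave p: [true] means along the edge towards its
   head, [false] towards its tail. *)
Definition directions p : {set 'I_m * bool} :=
  [set d | `[< exists s, [/\ 0 <= s <= L d.1, phi d.1 s = p &
                           if d.2 then s < L d.1 else 0 < s] >]]%SET.

(** Unit-speed germ leaving p, meaningful for d in [directions p] and small t >= 0. Edges are
    injectively parametrized, so p has at most one position on each. *)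
Definition edge_arm p d t : T :=
  phi d.1 (if d.2 then edge_pos d.1 p + t else edge_pos d.1 p - t).

Lemma dirsP p d : reflect (exists s, [/\ 0 <= s <= L d.1, phi d.1 s = p &
    if d.2 then s < L d.1 else 0 < s]) (d \in directions p).
Proof. by rewrite finset.inE; exact: asboolP. Qed.

Lemma dirs_pos p d : d \in directions p ->
  [/\ 0 <= edge_pos d.1 p <= L d.1, phi d.1 (edge_pos d.1 p) = p &
      if d.2 then edge_pos d.1 p < L d.1 else 0 < edge_pos d.1 p].
Proof. by move=> /dirsP[s [sL <- sd]]; rewrite edge_posE. Qed.

Lemma dirs_interior i s d : 0 < s < L i -> (d \in directions (phi i s)) = (d.1 == i).
Proof.
move=> sL; apply/dirsP/eqP => [[t [tL E _]]|di].
  by have [] := interior_inj sL tL (esym E).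
by exists s; rewrite di; split => //; [lra|case: ifP => _; lra].
Qed.

Lemma dirs_vertex p d : p \in V ->
  (d \in directions p) = (if d.2 then tail (O d.1) == p else Defs.head (O d.1) == p).
Proof.
move=> pV; have L0 := length_gt0 d.1; apply/dirsP/idP.
  move=> [s [sL sp sd]].
  have [s0|s0] := eqVneq s 0.
    case: ifP sd => _; last by rewrite s0 ltxx.
    by rewrite -edge_tail -sp s0 eqxx.
  have [s1|s1] := eqVneq s (L d.1).
    case: ifP sd => _; first by rewrite s1 ltxx.
    by rewrite -edge_head -sp s1 eqxx.
  have /interior_notin : 0 < s < L d.1 by rewrite !lt_neqAle s1 eq_sym s0.
  by rewrite sp pV.
case: ifP => _ /eqP E.
  by exists 0; rewrite edge_tail lexx (ltW L0).
by exists (L d.1); rewrite edge_head lexx (ltW L0).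
Qed.

Section Charts.
Variables (p : T) (n : nat) (r : R) (psi : 'I_n -> R -> T).
Hypothesis psiP : star_chart p r psi.

Lemma dirs_germ d : d \in directions p -> exists k e,
  [/\ 0 < e <= r, forall t, 0 <= t < e -> edge_arm p d t = psi k t &
      if d.2 then edge_pos d.1 p + e <= L d.1 else e <= edge_pos d.1 p].
Proof.
move=> /dirs_pos; rewrite /edge_arm; move: (edge_pos d.1 p) => s [sL sp].
case: ifP => _ sd.
  have [|k [e [e0 er eL ke]]] := arc_germ psiP (arc d.1) _ sp; first by lra.
  by exists k, e; split => //; apply/andP.
(* Going towards the tail is going forward on the reversed arc. *)
have [||k [e [e0 er eL ke]]] := arc_germ psiP (arc_rev (arc d.1)) (s := L d.1 - s).
- by lra.
- by rewrite subKr.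
exists k, e; split => [|t te|]; [lra| |lra].
by rewrite -ke //; congr (phi _ _); lra.
Qed.

(* Near p the k-th arm avoids V, hence stays in one component of the complement
   of V, whose closure contains p. *)
Lemma arm_in_edge k : exists i s e, [/\ 0 < e < r, 0 <= s <= L i, phi i s = p &
  forall t, 0 < t < e -> Defs.support (O i) (psi k t)].
Proof.
have r0 := star_gt0 psiP.
have [d d0 dV] : exists2 d, 0 < d & forall x, mdist p x < d -> x \in V -> x = p.
  have cl : closed ([set` V] `\ p).
    apply: (accessible_finite_set_closed.1
      (hausdorff_accessible (@metric_hausdorff _ T))).
    by apply: finite_setD; exact: finite_fset.
  have /nbhs_ballP[d /= d0 dV] : nbhs p (~` ([set` V] `\ p)).
    apply: open_nbhs_nbhs; split; first by rewrite openC.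
    by move=> [_ /(_ erefl)].
  exists d => // x xd xV; apply: contrapT => xp; apply: (dV x); last by split.
  by rewrite /= ballEmdist.
(* Halved so that the closed range t <= e stays strictly below both d and r. *)
pose e := Num.min d r / 2.
have e0 : 0 < Num.min d r by rewrite lt_min d0.
have [ed er] : Num.min d r <= d /\ Num.min d r <= r by rewrite !ge_min !lexx orbT.
have avoid t : 0 < t <= e -> (~` [set` V]) (psi k t).
  rewrite /e => te /= tV; have tr : 0 <= t < r by lra.
  have := star_dist_centre psiP k tr.
  rewrite (dV (psi k t)) ?mdistxx // ?(star_dist_centre psiP k tr); lra.
pose C := connected_component (~` [set` V]) (psi k e).
have CE : edge_sets [set` V] C.
  by exists (psi k e) => //; apply: avoid; rewrite /e; lra.
have inC t : 0 < t <= e -> C (psi k t).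
  move=> te; rewrite /C.
  apply: (@connected_component_max _ _ (psi k @` `[t, e])).
  - by exists e => //=; rewrite in_itv /= lexx; lra.
  - by move=> x [u /=]; rewrite in_itv /= => ut <-; apply: avoid; lra.
  - apply: connected_continuous_connected.
      by apply/connected_intervalP; exact: interval_is_interval.
    apply: (@lipschitz_within_continuous _ _ _ 1) => // u v x.
    rewrite !in_itv /= mul1r => ut vt uvx; rewrite ballEmdist /=.
    by rewrite (star_distE psiP) ?eqxx //; move: ut vt; rewrite /e; lra.
  - by exists t => //=; rewrite in_itv /= lexx; lra.
have [_ /(_ C CE)[i [iC _]]] := hO.
have [s sL sp] : exists2 s, 0 <= s <= L i & phi i s = p.
  apply: closure_supportP; rewrite iC => B /nbhs_ballP[x /= x0 xB].
  pose t := Num.min x e / 2.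
  have t0 : 0 < Num.min x e by rewrite lt_min x0 /e; lra.
  have [tx te] : Num.min x e <= x /\ Num.min x e <= e by rewrite !ge_min !lexx orbT.
  exists (psi k t); split; first by apply: inC; rewrite /t; lra.
  apply: xB; rewrite ballEmdist /= (star_dist_centre psiP).
    by rewrite /t; lra.
  by move: te; rewrite /t /e; lra.
exists i, s, e; split => // [|t te]; first by rewrite /e; lra.
by rewrite iC; apply: inC; lra.
Qed.

(** Converse of [dirs_germ]. A point of the arm close to p lies on an edge, at a parameter w close
    to that of p by continuity of the inverse. The side of w selects a direction; its germ runs
    along one arm and meets the k-th arm off the centre, so that arm is the k-th. *)
Lemma arm_dir k : exists d e,
  [/\ d \in directions p, 0 < e <= r, forall t, 0 <= t < e -> edge_arm p d t = psi k t &
      if d.2 then edge_pos d.1 p + e <= L d.1 else e <= edge_pos d.1 p].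
Proof.
have [i [s [e [er sL sp isupp]]]] := arm_in_edge k.
have pos_s : edge_pos i p = s by rewrite -sp edge_posE.
(* A radius is provided even for an absent direction (the value 1), so that both radii exist before
   the side of w is known. *)
have germ b : exists2 e, 0 < e & (i, b) \in directions p ->
    exists k, (e <= r /\ forall t, 0 <= t < e -> edge_arm p (i, b) t = psi k t) /\
      if b then s + e <= L i else e <= s.
  case: (boolP ((i, b) \in directions p)) => [/dirs_germ[k' [e' [e'r ke']]]|_].
    rewrite /= pos_s => H; exists e'; first by lra.
    by move=> _; exists k'; split => //; split => //; lra.
  by exists 1.
have [e1 e10 germ1] := germ true; have [e2 e20 germ2] := germ false.
have sin : s \in `[0, L i] by rewrite in_itv.
have e12 : 0 < Num.min e1 e2 by rewrite lt_min e10.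
have [em1 em2] : Num.min e1 e2 <= e1 /\ Num.min e1 e2 <= e2 by rewrite !ge_min !lexx orbT.
have [d d0 dP] := arc_inverse_continuous (arc i) sin e12.
pose t := Num.min d e / 2.
have t0 : 0 < Num.min d e by rewrite lt_min d0; lra.
have [td te] : Num.min d e <= d /\ Num.min d e <= e by rewrite !ge_min !lexx orbT.
have te' : 0 < t < e by rewrite /t; lra.
have tr : 0 < t < r by lra.
have [w wL wt] := supportP (isupp t te').
have ws : `|w - s| < Num.min e1 e2.
  apply: dP; first by rewrite in_itv /=; lra.
  rewrite wt sp (star_dist_centre psiP); [rewrite /t|]; lra.
case: (ltgtP w s) => [lt|gt|eq].
- have dir : (i, false) \in directions p by apply/dirsP; exists s; split => //=; lra.
  have [k' [[e2r kE] Hs]] := germ2 dir; exists (i, false), e2; split => //=;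
    last by rewrite pos_s.
    by rewrite e20.
  have ws2 : 0 <= s - w < e2 by move: ws; rewrite ltr0_norm; lra.
  have := kE (s - w) ws2; rewrite /edge_arm /= pos_s subKr wt.
  have ws2' : 0 <= s - w < r by lra.
  by move=> /(star_inj psiP tr ws2')[-> _] u /kE; rewrite /edge_arm /= pos_s.
- have dir : (i, true) \in directions p by apply/dirsP; exists s; split => //=; lra.
  have [k' [[e1r kE] Hs]] := germ1 dir; exists (i, true), e1; split => //=;
    last by rewrite pos_s.
    by rewrite e10.
  have ws1 : 0 <= w - s < e1 by move: ws; rewrite gtr0_norm; lra.
  have := kE (w - s) ws1; rewrite /edge_arm /= pos_s addrC subrK wt.
  have ws1' : 0 <= w - s < r by lra.
  by move=> /(star_inj psiP tr ws1')[-> _] u /kE; rewrite /edge_arm /= pos_s.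
- have tr' : 0 <= t < r by lra.
  by have := star_dist_centre psiP k tr'; rewrite -wt eq sp mdistxx; lra.
Qed.

(** Arms of any chart at p correspond bijectively to [directions p], with one radius for all arms.
    This makes sums over arms independent of the chart. *)
Lemma chart_dirs : exists (kappa : 'I_n -> 'I_m * bool) e,
  [/\ 0 < e <= r, injective kappa, directions p = (kappa @: [set: 'I_n])%SET,
      forall k t, 0 <= t < e -> edge_arm p (kappa k) t = psi k t &
      forall k, if (kappa k).2 then edge_pos (kappa k).1 p + e <= L (kappa k).1
                else e <= edge_pos (kappa k).1 p].
Proof.
have r0 := star_gt0 psiP.
have /choice[F FP] : forall k, exists F : ('I_m * bool) * R,
  [/\ F.1 \in directions p, 0 < F.2 <= r,
      forall t, 0 <= t < F.2 -> edge_arm p F.1 t = psi k t &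
      if F.1.2 then edge_pos F.1.1 p + F.2 <= L F.1.1 else F.2 <= edge_pos F.1.1 p].
  by move=> k; have [d [e H]] := arm_dir k; exists (d, e).
have [e' e'0 eF] : exists2 d, 0 < d & forall k, d <= (F k).2.
  by apply: finite_positive_lower_bound => k; have [_ /andP[]] := FP k.
pose e := Num.min e' r.
have e0 : 0 < e by rewrite lt_min e'0.
have [ee' er] : e <= e' /\ e <= r by rewrite !ge_min !lexx orbT.
clearbody e.
have armE k t : 0 <= t < e -> edge_arm p (F k).1 t = psi k t.
  by move=> te; have [_ _ -> //] := FP k; have := eF k; lra.
exists (fun k => (F k).1), e; split => //; first by rewrite e0.
- move=> k l E; have e2 : 0 <= e / 2 < e by lra.
  have := armE k _ e2; rewrite E armE // => /(star_inj psiP)[] //; lra.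
- apply/finset.setP => d; apply/idP/imsetP => [dp|[k _ ->]]; last by case: (FP k).
  have [k [x [xr kx dx]]] := dirs_germ dp; exists k; first by rewrite finset.inE.
  have [Fp _ _ Fx] := FP k; have Fe := eF k.
  (* At this time both germs are at the same point, strictly inside their edges: the edges agree,
     and opposite senses would give positions differing by 2t. *)
  pose t := Num.min e x / 2.
  have t0 : 0 < Num.min e x by rewrite lt_min e0; lra.
  have [te tx] : Num.min e x <= e /\ Num.min e x <= x by rewrite !ge_min !lexx orbT.
  have : edge_arm p d t = edge_arm p (F k).1 t.
    by rewrite armE ?kx // /t; lra.
  have [dL dpE _] := dirs_pos dp; have [FL FpE _] := dirs_pos Fp.
  have tt : 0 < t /\ 2 * t <= x /\ 2 * t <= (F k).2 by rewrite /t; lra.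
  rewrite /edge_arm; move: (F k).1 (F k).2 Fx FL FpE tt => [i b] y /= Fx FL FpE tt.
  case: d dx dL {dp kx} dpE => [j c] /= dx dL dpE.
  move=> /interior_inj[].
  + by case: c dx; lra.
  + by case: b Fx; lra.
  + move=> ij; rewrite {}ij in dx dL dpE *.
    by case: b Fx; case: c dx => //= dx Fx E; exfalso; lra.
- by move=> k; have [_ _ _] := FP k; have := eF k; case: ifP => _; lra.
Qed.

End Charts.

End Model.

Lemma star_chart_shrink (R : realType) (T : metricType R) (p : T) n r r'
    (psi : 'I_n -> R -> T) :
  star_chart p r psi -> 0 < r' <= r -> star_chart p r' psi.
Proof.
move=> psiP /andP[r'0 r'r]; have [r0 ctr iso _] := psiP; split => //.
  by move=> k l s t; rewrite !in_itv /= => sr tr; apply: iso; rewrite in_itv /=; lra.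
have [d d0 dP] := star_nbhs psiP.
apply/nbhs_ballP; exists (Num.min d r'); first by rewrite /= lt_min d0.
move=> x; rewrite ballEmdist /= lt_min => /andP[xd xr'].
have [k [t [tr xt]]] := dP x xd; exists k, t; rewrite in_itv /=; split => //.
by move: xr'; rewrite xt (star_dist_centre psiP); lra.
Qed.

(** * Slopes along directions and the Laplacian *)

Section Slopes.
Context {R : realType} {T : metricType R} (V : {fset T}) (m : nat).
Variables (O : 'I_m -> oriented_edge T) (L : 'I_m -> R) (phi : 'I_m -> R -> T).
Hypothesis hO : orientation [set` V] O.
Hypothesis phiP : forall i,
  [/\ arc_parametrization (closure (Defs.support (O i))) (L i) (phi i),
      phi i 0 = tail (O i) & phi i (L i) = Defs.head (O i)].
Implicit Types (p : T) (i : 'I_m) (d : 'I_m * bool) (f : T -> R).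
Local Notation arm := (edge_arm L phi).
Local Notation dirs := (directions L phi).

Definition slope_along f p d (a : R) := (f (arm p d t) - f p) / t @[t --> 0^'+] --> a.

Lemma sum_dirs_interior i s (F : 'I_m * bool -> R) : 0 < s < L i ->
  \sum_(d in dirs (phi i s)) F d = F (i, true) + F (i, false).
Proof.
move=> sL; under eq_bigl do rewrite (dirs_interior hO phiP) //.
rewrite (bigD1 (i, true)) //= (bigD1 (i, false)) /=;
  last by rewrite eqxx xpair_eqE andbF.
rewrite big1 ?addr0 //.
by case=> j [] /= /andP[/andP[/eqP ->]]; rewrite eqxx.
Qed.

Lemma sum_dirs_vertex p (F : 'I_m * bool -> R) : p \in V ->
  \sum_(d in dirs p) F d = \sum_i (F (i, true) * (tail (O i) == p)%:R +
                                   F (i, false) * (Defs.head (O i) == p)%:R).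
Proof.
move=> pV; rewrite big_mkcond /=.
pose G i b := if if b then tail (O i) == p else Defs.head (O i) == p
              then F (i, b) else 0.
rewrite (eq_bigr (fun d => G d.1 d.2)); last first.
  by case=> i b _; rewrite (dirs_vertex hO phiP).
rewrite -(pair_bigA _ G) /=; apply: eq_bigr => i _; rewrite big_bool /G /=.
by congr (_ + _); case: ifP => _; rewrite ?mulr1 ?mulr0.
Qed.

Lemma is_sigma_slopes f p s : is_sigma f p s -> exists a : 'I_m * bool -> R,
  (forall d, d \in dirs p -> slope_along f p d (a d)) /\ s = - \sum_(d in dirs p) a d.
Proof.
move=> [n [r [psi [a [psiP fa ->]]]]].
have [kappa [e [er kinj dE kE _]]] := chart_dirs hO phiP psiP.
(* The slopes on the arms, transported through the inverse of [kappa]; 0 is a default outside its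
   image. *)
pose b d := if [pick k | kappa k == d] is Some k then a k else 0.
have bE k : b (kappa k) = a k.
  rewrite /b; case: pickP => [l /eqP/kinj -> //|/(_ k)]; by rewrite eqxx.
exists b; split.
  rewrite dE => d /imsetP[k _ ->]; rewrite bE.
  apply: (cvg_at_right0_ext (e := e)) (fa k); first by case/andP: er.
  by move=> t te; rewrite kE //; lra.
congr (- _); rewrite dE big_imset /=; last by move=> ? ? _ _; exact: kinj.
by under [RHS]eq_bigr do rewrite bE; apply: eq_bigl => k; rewrite finset.inE.
Qed.

Lemma slopes_is_sigma f p n r (psi : 'I_n -> R -> T) a : star_chart p r psi ->
  (forall d, d \in dirs p -> slope_along f p d (a d)) ->
  is_sigma f p (- \sum_(d in dirs p) a d).
Proof.
move=> psiP fa; have [kappa [e [er kinj dE kE _]]] := chart_dirs hO phiP psiP.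
exists n, r, psi, (a \o kappa); split => // [k|].
  have kd : kappa k \in dirs p by rewrite dE imset_f ?finset.inE.
  apply: (cvg_at_right0_ext (e := e)) (fa _ kd); first by case/andP: er.
  by move=> t te; rewrite kE //; lra.
congr (- _); rewrite dE big_imset /=; last by move=> ? ? _ _; exact: kinj.
by apply: eq_bigl => k; rewrite finset.inE.
Qed.

(** The two arms are the two senses of the edge, in an unknown order; [c] keeps track of the sign on
    each arm. *)
Lemma affine_near_edge f i s : 0 < s < L i -> affine_near f (phi i s) ->
  locally_affine (f \o phi i) s.
Proof.
move=> sL [r [psi [a [psiP fa]]]].
have [kappa [e [/andP[e0 er] kinj dE kE _]]] := chart_dirs hO phiP psiP.
have onto b : exists k, kappa k = (i, b).
  have : (i, b) \in dirs (phi i s) by rewrite (dirs_interior hO phiP).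
  by rewrite dE => /imsetP[k _ ->]; exists k.
have [k1 k1E] := onto true; have [k2 k2E] := onto false.
have k12 : k1 != k2 by apply/eqP => k12; move: k2E; rewrite -k12 k1E.
pose c (k : 'I_2) := if k == ord0 then a else - a.
have fc k t : 0 <= t < e -> f (psi k t) = f (phi i s) + c k * t.
  move=> te; have [|f0 f1] := fa t; first by rewrite in_itv /=; lra.
  rewrite /c; case: (unliftP ord0 k) => [j ->|-> //].
  rewrite (_ : lift ord0 j = ord_max); last by apply/val_inj; rewrite /= (ord1 j).
  by rewrite f1 mulNr.
have c21 : c k2 = - c k1.
  move: k12; rewrite /c; case: (unliftP ord0 k1) => [j1 ->|->];
  case: (unliftP ord0 k2) => [j2 ->|->] //=; rewrite ?opprK //.
  by rewrite (ord1 j1) (ord1 j2) eqxx.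
have posi : edge_pos L phi i (phi i s) = s by apply: (edge_posE phiP); lra.
exists (c k1), e; split => // t te /=.
case: (leP s t) => st.
  have te' : 0 <= t - s < e by move: te; rewrite ger0_norm; lra.
  rewrite -fc // -kE // k1E /edge_arm /= posi; congr (f (phi i _)); lra.
have te' : 0 <= s - t < e by move: te; rewrite ltr0_norm; lra.
have -> : c k1 * (t - s) = c k2 * (s - t) by rewrite c21 mulNr -mulrN opprB.
rewrite -fc // -kE // k2E /edge_arm /= posi; congr (f (phi i _)); lra.
Qed.

(** Explicit outgoing slopes at every point: the form in which potentials are built, from which
    continuity, affinity and the Laplacian are read off. *)
Definition piecewise_slopes f (a : T -> 'I_m * bool -> R) : Prop :=
  forall p d, d \in dirs p ->
    exists2 e, 0 < e & forall t, 0 <= t < e -> f (arm p d t) = f p + a p d * t.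

Lemma piecewise_slopes_along f a p d : piecewise_slopes f a -> d \in dirs p ->
  slope_along f p d (a p d).
Proof.
move=> fa dp; have [e e0 fe] := fa p d dp.
apply: (@cvg_at_right0_ext _ (cst (a p d)) _ _ e) => //; last exact: cvg_cst.
move=> t te; rewrite fe; last by lra.
by rewrite addrC addKr mulfK // gt_eqF //; case/andP: te.
Qed.

Lemma piecewise_slopes_chart f a p n r (psi : 'I_n -> R -> T) :
  piecewise_slopes f a -> star_chart p r psi ->
  exists (kappa : 'I_n -> 'I_m * bool) e, [/\ 0 < e <= r, injective kappa,
    dirs p = (kappa @: [set: 'I_n])%SET &
    forall k t, 0 <= t < e -> f (psi k t) = f p + a p (kappa k) * t].
Proof.
move=> fa psiP; have [kappa [e [er kinj dE kE _]]] := chart_dirs hO phiP psiP.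
have /choice[F FP] : forall k, exists e, 0 < e /\
    forall t, 0 <= t < e -> f (arm p (kappa k) t) = f p + a p (kappa k) * t.
  move=> k; have kd : kappa k \in dirs p by rewrite dE imset_f ?finset.inE.
  by have [x x0 H] := fa p _ kd; exists x.
have [x x0 xF] := finite_positive_lower_bound (fun k => (FP k).1).
have [xe1 xe2] : Num.min x e <= x /\ Num.min x e <= e by rewrite !ge_min !lexx orbT.
exists kappa, (Num.min x e); split => //.
  by rewrite lt_min x0; lra.
move=> k t te; have Fk := xF k; rewrite -kE ?(FP k).2 //; lra.
Qed.

Hypothesis hT : metric_graph T.

Lemma piecewise_slopes_continuous f a : piecewise_slopes f a -> continuous f.
Proof.
move=> fa p; case: hT => _ _ _ /(_ p)[n [r [psi psiP]]] _.
have [kappa [e [er _ _ fk]]] := piecewise_slopes_chart fa psiP.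
have psiP' := star_chart_shrink psiP er.
have [d d0 dP] := star_nbhs psiP'.
(* [M] dominates the finitely many slopes at p; the 1 keeps it positive. *)
pose M := 1 + \sum_k `|a p (kappa k)|.
have M0 : 0 < M by rewrite ltr_wpDr // sumr_ge0.
apply/cvg_ballP => x x0.
apply/nbhs_ballP; exists (Num.min d (x / M)).
  by rewrite /= lt_min d0 divr_gt0.
move=> y; rewrite ballEmdist /= lt_min => /andP[yd yx].
have [k [t [te yt]]] := dP y yd.
move: yx; rewrite -ball_normE /= yt (star_dist_centre psiP') // ltr_pdivlMr // => tx.
rewrite fk // opprD addrA subrr sub0r normrN normrM.
have t0 : 0 <= t by case/andP: te.
apply: le_lt_trans tx; rewrite (ger0_norm t0) mulrC ler_wpM2l //.
rewrite /M (bigD1 k) //= addrCA lerDl addr_ge0 // sumr_ge0 //.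
Qed.

Hypothesis hV : vertex_set [set` V].

Lemma piecewise_slopes_affine_near f a i s : piecewise_slopes f a ->
  0 < s < L i -> a (phi i s) (i, true) + a (phi i s) (i, false) = 0 ->
  affine_near f (phi i s).
Proof.
move=> fa sL a0; case: hT => _ _ _ /(_ (phi i s))[n [r [psi psiP]]] _.
(* Every point of valency other than 2 is a vertex, and an interior point is not. *)
have n2 : n = 2%N.
  apply: contrapT => n2; case: hV => _ valV _.
  have /= := valV (phi i s) n (ex_intro _ r (ex_intro _ psi psiP)) n2.
  by rewrite (negbTE (interior_notin hO phiP sL)).
subst n.
have [kappa [e [er kinj dE fk]]] := piecewise_slopes_chart fa psiP.
have kI k : (kappa k).1 = i.
  by apply/eqP; rewrite -(dirs_interior hO phiP _ sL) dE imset_f ?finset.inE.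
have k01 : (kappa ord0).2 != (kappa ord_max).2.
  apply/eqP => k2; suff /kinj : kappa ord0 = kappa ord_max by [].
  by rewrite (surjective_pairing (kappa ord0)) k2 kI -(kI ord_max) -surjective_pairing.
exists e, psi, (a (phi i s) (kappa ord0)); split.
  exact: star_chart_shrink psiP er.
move=> t; rewrite in_itv /= => te; split; first exact: fk.
rewrite fk // -mulNr; congr (_ + _ * _).
move: k01 (kI ord0) (kI ord_max) => /=.
case: (kappa ord0) => j [] /=; case: (kappa ord_max) => j' [] //= _ -> ->; lra.
Qed.

(** The difference of f1 and f2 has no mass off V, so it is affine along each edge and its outgoing
    slopes at the ends are the difference quotients. Summing them over [dirs p] gives the divergence
    at p. *)
Lemma laplacian_edge_slopes f1 f2 y1 y2 q p :
  continuous_piecewise_affine f1 -> continuous_piecewise_affine f2 ->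
  laplacian_dirac_diff f1 y1 q -> laplacian_dirac_diff f2 y2 q ->
  y1 \in V -> y2 \in V -> p \in V ->
  \sum_i (((f1 (Defs.head (O i)) - f2 (Defs.head (O i))) -
           (f1 (tail (O i)) - f2 (tail (O i)))) / L i) *
         ((Defs.head (O i) == p)%:R - (tail (O i) == p)%:R)
  = (p == y1)%:R - (p == y2)%:R.
Proof.
move=> [_ fin1] [_ fin2] lap1 lap2 y1V y2V pV.
have /choice[a1 a1P] := fun x => is_sigma_slopes (lap1 x).
have /choice[a2 a2P] := fun x => is_sigma_slopes (lap2 x).
pose a x d := a1 x d - a2 x d.
have sum_a x : \sum_(d in dirs x) a x d = (x == y2)%:R - (x == y1)%:R.
  rewrite sumrB; have [_ E1] := a1P x; have [_ E2] := a2P x.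
  have [H1 H2] : \sum_(d in dirs x) a1 x d = (x == q)%:R - (x == y1)%:R /\
                 \sum_(d in dirs x) a2 x d = (x == q)%:R - (x == y2)%:R.
    by split; apply: oppr_inj; rewrite opprB.
  by rewrite H1 H2; lra.
pose g x := f1 x - f2 x.
have g_slope x d : d \in dirs x -> slope_along g x d (a x d).
  move=> dx; have H1 := (a1P x).1 d dx; have H2 := (a2P x).1 d dx.
  have e0 : (0 : R) < 1 by [].
  refine (@cvg_at_right0_ext _ (fun t => (f1 (arm x d t) - f1 x) / t -
     (f2 (arm x d t) - f2 x) / t) _ _ _ e0 _ (cvgB H1 H2)) => t _.
  by rewrite -mulrBl; congr (_ / t); rewrite /g; lra.
have edge i : a (tail (O i)) (i, true) = (g (Defs.head (O i)) - g (tail (O i))) / L i /\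
    a (Defs.head (O i)) (i, false) = - ((g (Defs.head (O i)) - g (tail (O i))) / L i).
  rewrite -(edge_tail phiP) -(edge_head phiP).
  pose B := [set x | ~ affine_near f1 x] `|` [set x | ~ affine_near f2 x].
  pose S := [set s | 0 <= s <= L i] `&` phi i @^-1` B.
  (* On the closed edge [edge_pos] inverts phi i, so S is contained in the image of the finite set
     B. *)
  have finS : finite_set S.
    have finB : finite_set B by rewrite finite_setU.
    apply: (sub_finite_set (B := edge_pos L phi i @` B)); last exact: finite_image.
    by move=> s [/= sL sB]; exists (phi i s) => //; exact: (edge_posE phiP).
  have := @piecewise_affine_slopes _ (g \o phi i) (L i) S
    (fun s => a (phi i s) (i, true)) (fun s => a (phi i s) (i, false)).
  apply => //.
  - exact: (length_gt0 phiP).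
  - move=> s sL nS.
    have [A1 A2] : affine_near f1 (phi i s) /\ affine_near f2 (phi i s).
      by split; apply: contrapT => nA; apply: nS; split => /=; [lra|left|lra|right].
    have [c1 [e1 [e10 H1]]] := affine_near_edge sL A1.
    have [c2 [e2 [e20 H2]]] := affine_near_edge sL A2.
    exists (c1 - c2), (Num.min e1 e2); split; first by rewrite lt_min e10.
    move=> t; rewrite lt_min => /andP[t1 t2].
    by have := H1 t t1; have := H2 t t2; rewrite /g /= => -> ->; ring.
  - move=> s sL; have sL' : 0 <= s <= L i by lra.
    have := g_slope (phi i s) (i, true).
    rewrite /slope_along /right_slope /edge_arm /= (edge_posE phiP) //; apply.
    by apply/dirsP; exists s; split => //=; lra.
  - move=> s sL; have sL' : 0 <= s <= L i by lra.
    have := g_slope (phi i s) (i, false).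
    rewrite /slope_along /left_slope /edge_arm /= (edge_posE phiP) //; apply.
    by apply/dirsP; exists s; split => //=; lra.
  - move=> s sL; rewrite -(sum_dirs_interior _ sL) sum_a.
    have /negbTE sV := interior_notin hO phiP sL.
    have neq y : y \in V -> (phi i s == y) = false.
      by move=> yV; apply: contraFF sV => /eqP ->.
    by rewrite !neq // subrr.
apply: oppr_inj; rewrite opprB -sum_a sum_dirs_vertex // -sumrN.
apply: eq_bigr => i _; have [E1 E2] := edge i.
have -> : a p (i, true) * (tail (O i) == p)%:R =
    a (tail (O i)) (i, true) * (tail (O i) == p)%:R.
  by case: eqP => [->|]; rewrite ?mulr0.
have -> : a p (i, false) * (Defs.head (O i) == p)%:R =
    a (Defs.head (O i)) (i, false) * (Defs.head (O i) == p)%:R.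
  by case: eqP => [->|]; rewrite ?mulr0.
by rewrite E1 E2 /g; ring.
Qed.

End Slopes.

(** * Discrete Poisson equation and existence of potentials *)

(** With M the weighted Laplacian, M x = 0 makes the weighted sum of squares of B x vanish, so M and
    B have the same kernel. A row vector that kills ker M lies in the row space of M. *)
Lemma weighted_laplacian_solvable (R : realFieldType) (m n : nat)
    (B : 'M[R]_(m, n)) (w : 'rV[R]_m) (e : 'rV[R]_n) :
  (forall i, 0 < w 0 i) -> (forall x : 'cV_n, B *m x = 0 -> e *m x = 0) ->
  exists h : 'rV_n, h *m (B^T *m diag_mx w *m B) = e.
Proof.
move=> w0 eB; set M := B^T *m _ *m B.
suff /submxP[h ->] : (e <= M)%MS by exists h.
rewrite submxE; apply/eqP/matrixP => a j.
pose x := cokermx M *m delta_mx j (0 : 'I_1); pose y := B *m x.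
have Mx : M *m x = 0 by rewrite mulmxA mulmx_coker mul0mx.
have y0 : y = 0.
  have : \sum_i w 0 i * y i 0 ^+ 2 = 0.
    transitivity ((y^T *m diag_mx w *m y) 0 0).
      rewrite mxE; apply: eq_bigr => i _; rewrite mul_mx_diag !mxE; ring.
    have -> : y^T *m diag_mx w *m y = x^T *m (M *m x) by rewrite /y trmx_mul /M !mulmxA.
    by rewrite Mx mulmx0 mxE.
  move=> /psumr_eq0P H; apply/matrixP => i b; rewrite ord1 [RHS]mxE.
  have /eqP : w 0 i * y i 0 ^+ 2 = 0.
    by apply: H => // k _; rewrite mulr_ge0 ?sqr_ge0 // ltW.
  by rewrite mulf_eq0 gt_eqF //= sqrf_eq0 => /eqP.
have : (e *m x) a 0 = 0 by rewrite (eB _ y0) mxE.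
by rewrite mulmxA -colE !mxE.
Qed.

Section Potentials.
Context {R : realType} {T : metricType R} (V : {fset T}) (m : nat).
Variables (O : 'I_m -> oriented_edge T) (L : 'I_m -> R) (phi : 'I_m -> R -> T).
Hypothesis hO : orientation [set` V] O.
Hypothesis phiP : forall i,
  [/\ arc_parametrization (closure (Defs.support (O i))) (L i) (phi i),
      phi i 0 = tail (O i) & phi i (L i) = Defs.head (O i)].
Hypothesis hT : metric_graph T.
Hypothesis hV : vertex_set [set` V].
Implicit Types (p : T) (i : 'I_m) (d : 'I_m * bool) (f : T -> R).
Local Notation arm := (edge_arm L phi).
Local Notation dirs := (directions L phi).
Local Notation hd i := (Defs.head (O i)).
Local Notation tl i := (Defs.tail (O i)).

Lemma edge_cover p : exists i s, 0 <= s <= L i /\ phi i s = p.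
Proof.
case: hT => _ _ _ /(_ p)[n [r [psi psiP]]] _.
have [d d0 dP] := star_nbhs psiP.
have [|k _] := dP p; first by rewrite mdistxx.
by have [i [s [_ [_ sL sp _]]]] := arm_in_edge hO phiP psiP k; exists i, s.
Qed.

(** Connectedness of the space, passed on to the combinatorial graph. *)
Lemma flat_potential_constant (X : T -> R) : (forall i, X (hd i) = X (tl i)) ->
  exists c, forall v, v \in V -> X v = c.
Proof.
move=> Xflat.
have [i0 _] : exists i : 'I_m, True.
  by case: hT => _ _ [x _] _ _; have [i _] := edge_cover x; exists i.
pose c := X (tl i0).
have Xedge i s : 0 <= s <= L i -> phi i s \in V -> X (phi i s) = X (tl i).
  move=> sL sV; have [->|s0] := eqVneq s 0; first by rewrite (edge_tail phiP).
  have [->|s1] := eqVneq s (L i); first by rewrite (edge_head phiP).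
  have /(interior_notin hO phiP) : 0 < s < L i.
    by rewrite !lt_neqAle s1 eq_sym s0.
  by rewrite sV.
(* The edges on which X is c and the others form two disjoint closed sets. *)
pose U (b : bool) := \bigcup_(i in [set i | (X (tl i) == c) = b]) (phi i @` `[0, L i]).
have closedU b : closed (U b).
  apply: closed_bigcup; first exact: finite_finset.
  move=> i _; case: (phiP i) => arc _ _; apply: (arc_image_closed arc) => //.
have UE : U true = ~` U false.
  apply/seteqP; split => x.
    move=> [i /= /eqP ic [s /=]]; rewrite in_itv /= => sL sx [j /= jc [t /=]].
    rewrite in_itv /= => tL tx.
    have [xV|xV] := boolP (x \in V).
      move: jc; rewrite -(Xedge j t) // ?tx // -sx (Xedge i s) ?sx //.
      by rewrite ic eqxx.
    rewrite -sx in xV; have sL' := edge_notin_interior hO phiP sL xV.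
    have [ij _] := interior_inj hO phiP sL' tL (etrans sx (esym tx)).
    by move: jc; rewrite -ij ic eqxx.
  move=> nx; have [i [s [sL sx]]] := edge_cover x.
  have ix : (phi i @` `[0, L i]) x by exists s => //=; rewrite in_itv.
  have [ic|ic] := boolP (X (tl i) == c); first by exists i.
  by case: nx; exists i => //=; apply: negbTE.
have UT : U true = setT.
  case: hT => _ conT _ _ _; apply: conT.
  - exists (tl i0), i0; first by rewrite /= /c eqxx.
    exists 0; last exact: (edge_tail phiP).
    by rewrite /= in_itv /= lexx ltW // (length_gt0 phiP).
  - by exists (~` U false); rewrite ?setTI // openC.
  - by exists (U true); rewrite ?setTI.
exists c => v vV; have : U true v by rewrite UT.
move=> [i /= /eqP <- [s /=]]; rewrite in_itv /= => sL sv.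
by rewrite -sv Xedge // sv.
Qed.

Lemma graph_poisson (e : T -> R) : \sum_(v : V) e (val v) = 0 ->
  exists X : T -> R, forall v, v \in V ->
    \sum_i ((X (hd i) - X (tl i)) / L i) * ((hd i == v)%:R - (tl i == v)%:R) = e v.
Proof.
move=> e0; pose vert (u : 'I_#|{: V}|) : T := val (enum_val u).
have vertP v : v \in V -> exists u, vert u = v.
  by move=> vV; exists (enum_rank [` vV]%fset); rewrite /vert enum_rankK.
have vert_inj : injective vert by move=> u u' /val_inj/enum_val_inj.
(* Extends a vector indexed by the vertices by zero to the whole space. *)
pose pot (x : 'I_#|{: V}| -> R) p := \sum_u x u * (p == vert u)%:R.
have potE x u : pot x (vert u) = x u.
  rewrite /pot (bigD1 u) //= eqxx mulr1 big1 ?addr0 // => u' uu'.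
  by rewrite (inj_eq vert_inj) eq_sym (negbTE uu') mulr0.
pose B : 'M[R]_(m, #|{: V}|) :=
  \matrix_(i, u) ((hd i == vert u)%:R - (tl i == vert u)%:R).
pose w : 'rV[R]_m := \row_i (L i)^-1.
have [||h hE] := @weighted_laplacian_solvable _ _ _ B w (\row_u e (vert u)).
- by move=> i; rewrite mxE invr_gt0 (length_gt0 phiP).
- move=> x Bx; have [i|c Xc] := @flat_potential_constant (pot (fun u => x u 0)).
    have /matrixP/(_ i 0) := Bx; rewrite !mxE => H; apply/eqP.
    rewrite -subr_eq0 -[X in _ == X]H -sumrB; apply/eqP; apply: eq_bigr => u _.
    by rewrite mxE; ring.
  apply/matrixP => a b; rewrite !ord1 !mxE.
  rewrite (eq_bigr (fun u => e (vert u) * c)).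
    rewrite -mulr_suml (_ : \sum_u _ = 0) ?mul0r // -[RHS]e0.
    rewrite (reindex (@enum_val _ {: V})) //=.
    exact: onW_bij (enum_val_bij _).
  by move=> u _; rewrite mxE -(Xc (vert u)) ?potE // /vert; exact: valP.
exists (pot (h 0)) => v /vertP[u <-].
have /matrixP/(_ 0 u) := hE; rewrite [RHS]mxE => <-.
rewrite !mulmxA mxE; apply: eq_bigr => i _; rewrite mul_mx_diag !mxE.
congr (_ / _ * _); rewrite -sumrB; apply: eq_bigr => u' _; rewrite !mxE; ring.
Qed.

(* The tent function with Laplacian delta_(s0) - (1 - s0 / l) delta_0
   - (s0 / l) delta_l on an edge of length l. *)
Definition tent (l s0 s : R) : R :=
  if s <= s0 then s * ((l - s0) / l) else s0 * ((l - s) / l).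

(** Right and left derivatives of [tent]. They differ only at s0, where the left one exceeds the
    right one by 1: this is the unit mass. *)
Definition tent_right (l s0 s : R) : R := if s < s0 then (l - s0) / l else - (s0 / l).
Definition tent_left (l s0 s : R) : R := if s <= s0 then (l - s0) / l else - (s0 / l).

Lemma tent_ge l s0 s : s0 <= s -> tent l s0 s = s0 * ((l - s) / l).
Proof.
by rewrite /tent le_eqVlt => /predU1P[->|s0s]; [rewrite lexx|rewrite leNgt s0s].
Qed.

Lemma tent_rightE l s0 s t : 0 <= t -> (s < s0 -> s + t <= s0) ->
  tent l s0 (s + t) = tent l s0 s + tent_right l s0 s * t.
Proof.
move=> t0; rewrite /tent_right; case: ltP => [s_lt /(_ isT) st|s_ge _].
  by rewrite /tent st (ltW s_lt); ring.
by rewrite !tent_ge; [ring| |lra].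
Qed.

Lemma tent_leftE l s0 s t : 0 <= t -> (s0 < s -> s0 <= s - t) ->
  tent l s0 (s - t) = tent l s0 s - tent_left l s0 s * t.
Proof.
move=> t0; rewrite /tent_left; case: leP => [s_le _|s_gt /(_ isT) st].
  by rewrite /tent s_le (_ : s - t <= s0); [ring|lra].
by rewrite !tent_ge; [ring|lra|].
Qed.

Section Existence.
Variables (y : T) (i0 : 'I_m) (s0 : R).
Hypotheses (yV : y \in V) (s0L : 0 <= s0 <= L i0).
Let q := phi i0 s0.

(* The mass at q is first split between the ends of its edge as in [tent], which
   leaves a Poisson equation on V; e is its right-hand side. *)
Lemma potential_exists : exists f,
  [/\ continuous_piecewise_affine f, laplacian_dirac_diff f y q & f q = 0].
Proof.
have [s0_ge0 s0_le] := andP s0L.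
have t1 : true%:R = 1 :> R by [].
have f0 : false%:R = 0 :> R by [].
have L0 i : L i != 0 by rewrite gt_eqF // (length_gt0 phiP).
pose e v : R := (v == y)%:R - (1 - s0 / L i0) * (v == tl i0)%:R
                - (s0 / L i0) * (v == hd i0)%:R.
have [|X XE] := @graph_poisson e.
  have one v : v \in V -> \sum_(u : V) (val u == v)%:R = 1 :> R.
    move=> vV; rewrite (bigD1 [` vV]%fset) //= eqxx big1 ?addr0 // => u.
    by rewrite -val_eqE /= => /negbTE ->.
  rewrite !sumrB -!mulr_sumr !one //; first by ring.
    exact: head_vertex hO _.
  exact: tail_vertex hO _.
pose D i := (X (hd i) - X (tl i)) / L i.
(* Linear interpolation of X, minus a tent on the edge of q that contributes the mass -1 at q and
   cancels the two correction terms of [e]. *)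
pose u i s := X (tl i) + D i * s - (i == i0)%:R * tent (L i0) s0 s.
have u_vertex i s : 0 <= s <= L i -> phi i s \in V -> u i s = X (phi i s).
  move=> sL sV; rewrite /u.
  have [->|sn0] := eqVneq s 0.
    rewrite (edge_tail phiP) mulr0 addr0 /tent.
    case: eqP => [E|_]; last by rewrite mul0r subr0.
    by rewrite s0_ge0 mul0r mulr0 subr0.
  have [->|sn1] := eqVneq s (L i).
    rewrite (edge_head phiP) /D mulfVK // [X (tl i) + _]addrC subrK.
    case: eqP => [E|_]; last by rewrite mul0r subr0.
    by rewrite tent_ge; [rewrite E subrr mul0r !mulr0 subr0|rewrite E].
  have /(interior_notin hO phiP) : 0 < s < L i.
    by rewrite !lt_neqAle sn1 eq_sym sn0.
  by rewrite sV.
(* The edge functions glue: at vertices they all take the values of X. *)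
have /choice[F FE] : forall p, exists F : R,
    forall i s, 0 <= s <= L i -> phi i s = p -> F = u i s.
  move=> p; have [pV|pV] := boolP (p \in V).
    by exists (X p) => i s sL sp; rewrite u_vertex ?sp.
  have [i [s [sL sp]]] := edge_cover p; exists (u i s) => j t tL tp.
  have sL' : 0 < s < L i by apply: (edge_notin_interior hO phiP sL); rewrite sp.
  have [ij st] := interior_inj hO phiP sL' tL (etrans sp (esym tp)).
  by rewrite ij st.
pose f p := F p - F q.
have fE i s : 0 <= s <= L i -> f (phi i s) = u i s - F q.
  by move=> sL; rewrite /f (FE _ i s).
pose a p d : R := let s := edge_pos L phi d.1 p in
  if d.2 then D d.1 - (d.1 == i0)%:R * tent_right (L i0) s0 s
  else - D d.1 + (d.1 == i0)%:R * tent_left (L i0) s0 s.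
have fa : piecewise_slopes L phi f a.
  move=> p [i b] /(dirs_pos phiP)[]; rewrite /= /a /edge_arm /=.
  move: (edge_pos L phi i p) => s sL <- {p}; case: b => sd.
    (* Stops at the peak of the tent if it lies ahead, otherwise at the end of the edge. *)
    exists (if s < s0 then Num.min (s0 - s) (L i - s) else L i - s).
      by case: ifP => ss; rewrite ?lt_min; lra.
    move=> t te; have [t0 tL ts] : [/\ 0 <= t, t <= L i - s & s < s0 -> s + t <= s0].
      by case: ifP te => ss; rewrite ?lt_min => te; split => //; lra.
    rewrite !fE //; last by lra.
    by rewrite /u tent_rightE //; ring.
  exists (if s0 < s then Num.min (s - s0) s else s).
    by case: ifP => ss; rewrite ?lt_min; lra.
  move=> t te; have [t0 tL ts] : [/\ 0 <= t, t <= s & s0 < s -> s0 <= s - t].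
    by case: ifP te => ss; rewrite ?lt_min => te; split => //; lra.
  rewrite !fE //; last by lra.
  by rewrite /u tent_leftE //; ring.
have interior_sum i s : 0 < s < L i ->
    a (phi i s) (i, true) + a (phi i s) (i, false) = (phi i s == q)%:R.
  move=> sL; have sL' : 0 <= s <= L i by lra.
  rewrite /a /= (edge_posE phiP) //.
  have [ii|ii] := eqVneq i i0; last first.
    rewrite !mul0r; case: eqP => [E|_]; last by rewrite subr0 addr0 subrr.
    by have [E' _] := interior_inj hO phiP sL s0L E; rewrite E' eqxx in ii.
  have -> : (phi i s == q) = (s == s0).
    apply/eqP/eqP => [E|->]; last by rewrite ii.
    by have [_ ->] := interior_inj hO phiP sL s0L E.
  rewrite /tent_right /tent_left !mul1r.
  have L1 : (L i0 - s0) / L i0 + s0 / L i0 = 1.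
    by rewrite -mulrDl subrK divff.
  by case: ltgtP => ss /=; lra.
exists f; split; last by rewrite /f subrr.
- split; first exact: (piecewise_slopes_continuous hO phiP hT fa).
  apply: (sub_finite_set (B := [set` V] `|` [set q])).
    move=> p /= np; apply: contrapT => /not_orP[/= /negP pV pq]; apply: np.
    have [i [s [sL sp]]] := edge_cover p.
    have sL' : 0 < s < L i by apply: (edge_notin_interior hO phiP sL); rewrite sp.
    rewrite -sp; apply: (piecewise_slopes_affine_near hO phiP hT hV fa sL').
    by rewrite interior_sum // sp; move/eqP/negbTE: pq => ->.
  by rewrite finite_setU; split; [exact: finite_fset|exact: finite_set1].
- move=> p; case: hT => _ _ _ /(_ p)[n [r [psi psiP]]] _.
  have := slopes_is_sigma hO phiP psiP (fun d dp => piecewise_slopes_along fa dp).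
  congr is_sigma; have [pV|pV] := boolP (p \in V); last first.
    have [i [s [sL sp]]] := edge_cover p.
    have sL' : 0 < s < L i by apply: (edge_notin_interior hO phiP sL); rewrite sp.
    rewrite -sp (sum_dirs_interior hO phiP) // interior_sum //.
    have -> : (phi i s == y) = false.
      by apply: contraNF pV => /eqP E; rewrite -sp E.
    by rewrite sub0r.
  rewrite (sum_dirs_vertex hO phiP) //.
  have pos0 i : tl i = p -> edge_pos L phi i p = 0.
    move=> <-; rewrite -(edge_tail phiP) (edge_posE phiP) // lexx.
    exact/ltW/(length_gt0 phiP).
  have posL i : hd i = p -> edge_pos L phi i p = L i.
    move=> <-; rewrite -(edge_head phiP) (edge_posE phiP) // lexx andbT.
    exact/ltW/(length_gt0 phiP).
  have -> : \sum_i (a p (i, true) * (tl i == p)%:R + a p (i, false) * (hd i == p)%:R) =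
      - e p - tent_right (L i0) s0 0 * (tl i0 == p)%:R
      + tent_left (L i0) s0 (L i0) * (hd i0 == p)%:R.
    transitivity (\sum_i (- (D i * ((hd i == p)%:R - (tl i == p)%:R)) +
        (i == i0)%:R * (- tent_right (L i0) s0 0 * (tl i == p)%:R +
                        tent_left (L i0) s0 (L i0) * (hd i == p)%:R))).
      apply: eq_bigr => i _; rewrite /a /=.
      have [ti|_] := eqVneq (tl i) p; have [hi|_] := eqVneq (hd i) p.
      (* A loop would place p at both 0 and L i. *)
      - by move: (L0 i); rewrite -(posL _ hi) (pos0 _ ti) eqxx.
      - rewrite (pos0 _ ti); case: (eqVneq i i0) => [->|_]; rewrite ?t1 ?f0; ring.
      - rewrite (posL _ hi); case: (eqVneq i i0) => [->|_]; rewrite ?t1 ?f0; ring.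
      - rewrite f0; ring.
    rewrite big_split /= sumrN XE // (bigD1 i0) //= eqxx t1 big1 ?addr0; first ring.
    by move=> i /negbTE ->; rewrite mul0r.
  have L00 := length_gt0 phiP i0.
  have qtl : s0 = 0 -> q = tl i0 by move=> E; rewrite /q E (edge_tail phiP).
  have qhd : s0 = L i0 -> q = hd i0 by move=> E; rewrite /q E (edge_head phiP).
  rewrite /e /tent_right /tent_left (eq_sym p (tl i0)) (eq_sym p (hd i0)).
  (* If q is an end of its edge, the tent is zero on that edge and the mass at q comes from [e]
     alone. *)
  have [E0|n0] := eqVneq s0 0.
    rewrite (qtl E0) E0 ltxx leNgt L00 /= (eq_sym p (tl i0)); ring.
  have [E1|n1] := eqVneq s0 (L i0).
    rewrite (qhd E1) E1 L00 lexx /= subrr divff // (eq_sym p (hd i0)); ring.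
  have s0L' : 0 < s0 < L i0 by rewrite !lt_neqAle n1 eq_sym n0.
  have -> : (p == q) = false.
    apply: contraTF pV => /eqP ->; exact: (interior_notin hO phiP).
  have -> : 0 < s0 by lra.
  have -> : (L i0 <= s0) = false by lra.
  rewrite /= (_ : (L i0 - s0) / L i0 = 1 - s0 / L i0); last by rewrite mulrBl divff.
  by ring.
Qed.

End Existence.

(** Existence of one candidate transfers the defining properties to the function chosen by
    [xget]. *)
Lemma jfunP (z y : T) : y \in V ->
  [/\ continuous_piecewise_affine (jfun z y), laplacian_dirac_diff (jfun z y) y z
    & jfun z y z = 0].
Proof.
move=> yV; have [i [s [sL <-]]] := edge_cover z.
exact: (xgetPex (fun=> 0) (potential_exists yV sL)).
Qed.

End Potentials.

(** * The matrices of the two projections *)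

Lemma daddv_pi_eq0 (K : fieldType) (vT : vectType K) (U W : {vspace vT}) w :
  (U :&: W = 0)%VS -> w \in W -> daddv_pi U W w = 0.
Proof.
move=> UW wW; have := daddv_pi_add UW (subvP (addvSr U W) _ wW).
by rewrite (@daddv_pi_id _ _ W U) // 1?capvC // -[RHS]add0r => /addIr.
Qed.

Theorem theoremC (R : realType) (T : metricType R) (hT : metric_graph T)
    (V : {fset T}) (hV : vertex_set [set` V])
    (m : nat) (O : 'I_m -> oriented_edge T) (hO : orientation [set` V] O)
    (q : T) :
  endo_mx (pi_H1 V O) = 1%:M - invmx (length_mx O) *m cross_ratio_mx O q /\
  endo_mx (pi_H1perp V O) = invmx (length_mx O) *m cross_ratio_mx O q.
Proof.
have /choice[L] : forall i, exists L, exists phi,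
    [/\ arc_parametrization (closure (Defs.support (O i))) L phi,
        phi 0 = tail (O i) & phi L = Defs.head (O i)].
  by move=> i; case: hO => /(_ i)[].
move=> /choice[phi phiP].
have L0 i : L i != 0 by rewrite gt_eqF // (length_gt0 phiP).
(* The cross ratio of the edges i and j, regrouped, is the increment of [pot j] from tail to head of
   i. *)
pose pot j p := jfun q (Defs.head (O j)) p - jfun q (tail (O j)) p.
pose P := \matrix_(i < m, j < m)
  ((pot j (Defs.head (O i)) - pot j (tail (O i))) / L i).
have PE : invmx (length_mx O) *m cross_ratio_mx O q = P.
  have Dunit : length_mx O \in unitmx.
    rewrite unitmxE det_diag unitfE; apply/prodf_neq0 => i _.
    by rewrite mxE (edge_lengthE phiP).
  rewrite -[RHS](mulKmx Dunit); congr (_ *m _); apply/matrixP => i j.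
  rewrite mul_diag_mx !mxE (edge_lengthE phiP) mulrC divfK // /cross_ratio /pot; ring.
have P_div j p : p \in V -> \sum_i P i j *
    ((Defs.head (O i) == p)%:R - (tail (O i) == p)%:R) =
    (p == Defs.head (O j))%:R - (p == tail (O j))%:R.
  move=> pV.
  have [c1 l1 _] := jfunP hO phiP hT hV q (head_vertex hO j).
  have [c2 l2 _] := jfunP hO phiP hT hV q (tail_vertex hO j).
  rewrite -(laplacian_edge_slopes hO phiP c1 c2 l1 l2)
    ?(head_vertex hO) ?(tail_vertex hO) //.
  by apply: eq_bigr => i _; rewrite mxE.
have H1P (c : 'cV[R]_m) : reflect (forall p, p \in V -> \sum_i c i 0 *
    ((Defs.head (O i) == p)%:R - (tail (O i) == p)%:R) = 0) (c \in H1 V O).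
  rewrite memv_ker lfunE /=; apply: (iffP eqP) => [c0 p pV|c0].
    by have /ffunP/(_ [` pV]%fset) := c0; rewrite !ffunE.
  by apply/ffunP => v; rewrite !ffunE c0 //; exact: valP.
have P_perp j : col j P \in H1perp V O.
  apply/mem_orthovP => c /H1P c0; rewrite /= /edge_form.
  (* The length in [edge_form] cancels the one dividing the increment, leaving the pairing of
     [pot j] with the boundary of c. *)
  transitivity (\sum_(v : V) pot j (val v) * \sum_i c i 0 *
      ((Defs.head (O i) == val v)%:R - (tail (O i) == val v)%:R)).
    have pot_sum p : p \in V -> \sum_(v : V) pot j (val v) * (p == val v)%:R = pot j p.
      move=> pV; rewrite (bigD1 [` pV]%fset) //= eqxx mulr1 big1 ?addr0 // => v.
      by rewrite -val_eqE /= eq_sym => /negbTE ->; rewrite mulr0.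
    under [RHS]eq_bigr do rewrite mulr_sumr.
    rewrite exchange_big /=; apply: eq_bigr => i _.
    rewrite (edge_lengthE phiP) !mxE mulrC [L i * _]mulrC divfK //.
    rewrite -(pot_sum _ (head_vertex hO i)) -(pot_sum _ (tail_vertex hO i)).
    rewrite -sumrB mulr_sumr; apply: eq_bigr => v _; ring.
  by rewrite big1 // => v _; rewrite c0 ?mulr0 //; exact: valP.
have P_cycle j : delta_mx j 0 - col j P \in H1 V O.
  apply/H1P => p pV.
  rewrite (eq_bigr (fun i =>
    (i == j)%:R * ((Defs.head (O i) == p)%:R - (tail (O i) == p)%:R)
     - P i j * ((Defs.head (O i) == p)%:R - (tail (O i) == p)%:R))); last first.
    by move=> i _; rewrite !mxE eqxx andbT mulrBl.
  rewrite sumrB P_div // (bigD1 j) //= eqxx mul1r big1 ?addr0.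
    by rewrite ![_ == p]eq_sym subrr.
  by move=> i /negbTE ->; rewrite mul0r.
(* [edge_form] is positive definite because the lengths are positive. *)
have cap0 : (H1 V O :&: H1perp V O = 0)%VS.
  apply/eqP; rewrite -subv0; apply/subvP => c; rewrite memv_cap memv0 => /andP[cH cP].
  have := mem_orthovP cP c cH; rewrite /= /edge_form => /psumr_eq0P c0.
  apply/eqP/matrixP => i b; rewrite ord1 mxE; apply/eqP.
  have /eqP : edge_length (O i) * c i 0 * c i 0 = 0.
    apply: c0 => // k _; rewrite -mulrA mulr_ge0 -?expr2 ?sqr_ge0 //.
    by rewrite (edge_lengthE phiP) ltW // (length_gt0 phiP).
  by rewrite (edge_lengthE phiP) !mulf_eq0 (negbTE (L0 i)) /= orbb.
(* This splitting into a cycle and a chain orthogonal to cycles gives column j of both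
   projections. *)
have deltaE j : delta_mx j 0 = (delta_mx j 0 - col j P) + col j P by rewrite subrK.
have cap0' : (H1perp V O :&: H1 V O = 0)%VS by rewrite capvC.
rewrite PE; split; apply/matrixP => i j; rewrite mxE deltaE linearD /=.
  rewrite /pi_H1 (daddv_pi_id cap0) // (daddv_pi_eq0 cap0) // addr0 !mxE.
  by rewrite eqxx andbT.
by rewrite /pi_H1perp (daddv_pi_eq0 cap0') // (daddv_pi_id cap0') // add0r mxE.
Qed.
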